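(* Let $(X,\mu,\Gamma)$ be a diffusion Markov triple with function spaces $\mathcal{A}_0\subset\mathcal{A}$ and operator $L$ (all as specified in the context, including $\Gamma:\mathcal{A}\times\mathcal{A}\to\mathcal{A}$), and let $F\in C^\infty(\mathbb{R})$. Assume that $(X,\mu,\Gamma)$ satisfies the curvature dimension condition $CD(K,\infty)$ for some $K\ge 0$. For $(x,y)\in X\times X$ let $$d(x,y):=\operatorname{esssup}\{f(x)-f(y)\},$$ where the essential supremum is computed over bounded functions $f\in\mathcal{A}$ with $\Gamma(f)\le 1$. Let $x_0\in X$ and $\rho(x):=d(x,x_0)$ for $x\in X$, and suppose that there exist a sequence of functions $\rho_k\in\mathcal{A}$ and a constant $C_0>0$ such that $$\rho_k\to\rho\quad \mu\text{-a.e. in }X\qquad\text{and}\qquad \|\Gamma(\rho_k)\|_{L^\infty}\le C_0\ \text{ for all }k.$$ Let $u\in\mathcal{A}$ be a stable (weak) solution of $Lu+F(u)=0$ in $X$ with $$\int_X\Gamma(u)\,d\mu<\infty.$$ Then: (i) if $K>0$, then $\Gamma(u)=0$ $\mu$-a.e. in $X$; (ii) if $K=0$, then $\Gamma_2(u)-\Gamma\big(\Gamma(u)^{1/2}\big)=0$ $\mu$-a.e. in $X$; (iii) if $K>0$ and moreover $\Gamma(u)\in\mathcal{A}\cap C^0(X)$, then $u$ is constant in $X$.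
   Context: Diffusion Markov triple. $(X,\tau)$ is a Polish space endowed with a $\sigma$-finite Borel measure $\mu$ with full support, $\mathcal{A}_0$ is a class of real-valued measurable functions on $X$, and $\Gamma:\mathcal{A}_0\times\mathcal{A}_0\to\mathcal{A}_0$ (the carré du champ) is a symmetric bilinear map, such that: (1) $\mathcal{A}_0\subset L^1(\mu)$ is a vector space, dense in every $L^p(\mu)$, $1\le p<\infty$, closed under products, and $\Psi(f_1,\dots,f_k)\in\mathcal{A}_0$ whenever $f_1,\dots,f_k\in\mathcal{A}_0$, $\Psi\in C^\infty(\mathbb{R}^k)$, $\Psi(0)=0$. (2) $\Gamma(f):=\Gamma(f,f)\ge 0$ for $f\in\mathcal{A}_0$, and for $f_1,\dots,f_k,g\in\mathcal{A}_0$ and $\Psi\in C^\infty(\mathbb{R}^k)$ with $\Psi(0)=0$, $\Gamma(\Psi(f_1,\dots,f_k),g)=\sum_{i=1}^k\partial_i\Psi(f_1,\dots,f_k)\Gamma(f_i,g)$ $\mu$-a.e. (3) For every $f\in\mathcal{A}_0$ there is $C=C(f)>0$ with $|\int_X\Gamma(f,g)\,d\mu|\le C\|g\|_{L^2(\mu)}$ for every $g\in\mathcal{A}_0$. Set $\mathcal{E}(f,g):=\int_X\Gamma(f,g)\,d\mu$ on $\mathcal{A}_0\times\mathcal{A}_0$; $\mathcal{D}(\mathcal{E})$ is the completion of $\mathcal{A}_0$ for the norm $(\|f\|_{L^2(\mu)}^2+\mathcal{E}(f,f))^{1/2}$, and $\mathcal{E}$ and $\Gamma$ are extended to $\mathcal{D}(\mathcal{E})$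 by continuity. (4) $L$ is the linear operator on $\mathcal{A}_0$ defined by $\int_X gLf\,d\mu=-\int_X\Gamma(f,g)\,d\mu$ for all $f,g\in\mathcal{A}_0$. Its domain $\mathcal{D}(L)$ is the set of $f\in\mathcal{D}(\mathcal{E})$ for which there is a constant $C>0$ with $|\mathcal{E}(f,g)|\le C\|g\|_{L^2(\mu)}$ for every $g\in\mathcal{D}(\mathcal{E})$; $L$ is extended to $\mathcal{D}(L)$ by the integration by parts formula against every $g\in\mathcal{D}(\mathcal{E})$ (and $L$ on $\mathcal{D}(L)$ is self-adjoint). (5) There is an increasing sequence $(\xi_k)_{k\ge1}\subset\mathcal{A}_0$ with $\xi_k(x)\in[0,1]$ for all $x\in X$, $\xi_k\to1$ $\mu$-a.e. in $X$, and $\Gamma(\xi_k)\le 1/k$ for $k\ge1$. There is also an algebra $\mathcal{A}\supset\mathcal{A}_0$ of measurable functions on $X$, containing the constants, such that: (1') if $f\in\mathcal{A}$ and $h\in\mathcal{A}_0$ then $hf\in\mathcal{A}_0$; (2') if $f\in\mathcal{A}$ and $\int_X hf\,d\mu\ge0$ for every positive $h\in\mathcal{A}_0$, then $f\ge0$; (3') if $f_1,\dots,f_k\in\mathcal{A}$ and $\Psi\in C^\infty(\mathbb{R}^k)$ with $\Psi(0)=0$, then $\Psi(f_1,\dots,f_k)\in\mathcal{A}$, and for $g\in\mathcal{A}$, $\Gamma(\Psi(f_1,\dots,f_k),g)=\sum_{i=1}^k\partial_i\Psi(f_1,\dots,f_k)\Gamma(f_i,g)$ $\mu$-a.e.; (4')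 $L:\mathcal{A}\to\mathcal{A}$ is an extension of $L$ on $\mathcal{A}_0$, and $\Gamma$ is defined on $\mathcal{A}\times\mathcal{A}$ by $\Gamma(f,g)=\frac12[L(fg)-fLg-gLf]\in\mathcal{A}$, with $\Gamma(f):=\Gamma(f,f)$; (5') $\Gamma(f)\ge0$ for every $f\in\mathcal{A}$; (6') for $f\in\mathcal{A}$, $g\in\mathcal{A}_0$, $\int_X\Gamma(f,g)\,d\mu=-\int_X gLf\,d\mu=-\int_X fLg\,d\mu$; (7') if $f\in\mathcal{A}$ and $\Gamma(f)=0$ then $f$ is constant. The carré du champ itéré is $\Gamma_2(f,g):=\frac12[L\Gamma(f,g)-\Gamma(f,Lg)-\Gamma(g,Lf)]$ for $f,g\in\mathcal{A}$, and $\Gamma_2(f):=\Gamma_2(f,f)$. The condition $CD(K,\infty)$, $K\in\mathbb{R}$, means $\Gamma_2(f)\ge K\Gamma(f)$ for every $f\in\mathcal{A}$. $u$ is a weak solution of $Lu+F(u)=0$ in $X$ if $u\in\mathcal{A}$ and $\int_X\Gamma(u,\varphi)\,d\mu=\int_X F(u)\varphi\,d\mu$ for all $\varphi\in\mathcal{A}_0$. A weak solution $u$ is stable if $\int_X\Gamma(\varphi)\,d\mu-\int_X F'(u)\varphi^2\,d\mu\ge0$ for all $\varphi\in\mathcal{A}_0$. The expression $\Gamma(\Gamma(u)^{1/2})$ is understood via the chain rule: it equals $\Gamma(\Gamma(u))/(4\Gamma(u))$ on $\{\Gamma(u)\neq0\}$ and $0$ on $\{\Gamma(u)=0\}$. 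*)

(* Defs.v *)
From HB Require Import structures.
From mathcomp Require Import all_boot all_order all_algebra.
From mathcomp Require Import all_classical all_reals all_analysis.
From mathcomp Require Import measurable_realfun.

Set Implicit Arguments.
Unset Strict Implicit.
Unset Printing Implicit Defensive.

Import Order.TTheory GRing.Theory Num.Theory.
Import numFieldNormedType.Exports.

Local Open Scope classical_set_scope.
Local Open Scope ring_scope.

(* The carrier of X with its Borel sigma-algebra; convertible to X. *)
Notation borel X := (g_sigma_algebraType (@open X)).

Definition polish_space (R : realType) (X : topologicalType) : Prop :=
  (exists2 D : set X, countable D & dense D) /\
  exists dist : X -> X -> R,
    [/\ forall x y, dist x y = 0 <-> x = y,
        forall x y, dist x y = dist y x,
        forall x y z, dist x z <= dist x y + dist y z,
        forall (x : X) (U : set X), nbhs x U <->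
          exists2 e : R, 0 < e & [set y | dist x y < e] `<=` U &
        forall s : nat -> X,
          (forall e : R, 0 < e -> exists N : nat, forall m n : nat,
             (N <= m)%N -> (N <= n)%N -> dist (s m) (s n) < e) ->
          exists x : X, s n @[n --> \oo] --> x].

Definition full_support (R : realType) (X : ptopologicalType)
    (mu : {measure set (borel X) -> \bar R}) : Prop :=
  forall U : set X, open U -> U !=set0 -> (0 < mu U)%E.

Definition partial (R : realType) (k : nat) (i : 'I_k) (Psi : 'rV[R]_k -> R) :
    'rV[R]_k -> R :=
  fun a => 'D_(delta_mx 0 i) Psi a.

Definition iter_partial (R : realType) (k : nat) (s : seq 'I_k)
    (Psi : 'rV[R]_k -> R) : 'rV[R]_k -> R :=
  foldr (@partial R k) Psi s.

(* C^oo(R^k): all iterated partial derivatives exist and are continuous. *)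
Definition smooth (R : realType) (k : nat) (Psi : 'rV[R]_k -> R) : Prop :=
  forall s : seq 'I_k,
    continuous (iter_partial s Psi) /\
    forall (i : 'I_k) (a : 'rV[R]_k),
      derivable (iter_partial s Psi) a (delta_mx 0 i).

Definition smooth1 (R : realType) (F : R -> R) : Prop :=
  forall (n : nat) (x : R), derivable (derive1n n F) x 1.

Definition row_at (R : realType) (T : Type) (k : nat) (f : 'I_k -> T -> R)
    (x : T) : 'rV[R]_k :=
  \row_i f i x.

Section dirichlet_form.
Context (R : realType) (X : ptopologicalType).
Variables (mu : {measure set (borel X) -> \bar R}) (A0 : set (X -> R))
  (Gamma : (X -> R) -> (X -> R) -> X -> R).

Definition energy (f g : X -> R) : \bar R := (\int[mu]_x (Gamma f g x)%:E)%E.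

(* A form-Cauchy sequence of A0 with L^2 limit f.  By the bound required in
   [energy_bounded] below the form is closable, so the completion of A0 is a
   set of square-integrable functions, each described by such sequences. *)
Definition energy_approx (f_ : nat -> X -> R) (f : X -> R) : Prop :=
  [/\ forall n, A0 (f_ n),
      Lnorm mu 2%:E (EFin \o (f_ n \- f)%R) @[n --> \oo] --> 0%E &
      forall e : R, 0 < e -> exists N : nat, forall m n : nat,
        (N <= m)%N -> (N <= n)%N ->
        (energy (f_ m \- f_ n)%R (f_ m \- f_ n)%R <= e%:E)%E].

Definition dom_energy (f : X -> R) : Prop :=
  f \in Lfun mu 2%:E /\ exists f_, energy_approx f_ f.

(* [ext_energy f g l]: the form extended to its domain takes the value l. *)
Definition ext_energy (f g : X -> R) (l : R) : Prop :=
  exists f_ g_, [/\ energy_approx f_ f, energy_approx g_ g &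
    energy (f_ n) (g_ n) @[n --> \oo] --> l%:E].

Definition dom_generator (f : X -> R) : Prop :=
  dom_energy f /\ exists2 C : R, 0 < C &
    forall g l, dom_energy g -> ext_energy f g l ->
      (`|l|%:E <= C%:E * Lnorm mu 2%:E (EFin \o g))%E.

(* The graph of L on its domain D(L). *)
Definition generator (f h : X -> R) : Prop :=
  [/\ dom_generator f, h \in Lfun mu 2%:E &
    forall g l, dom_energy g -> ext_energy f g l ->
      (\int[mu]_x (g x * h x)%:E = (- l)%:E)%E].

Definition generator_self_adjoint : Prop :=
  forall f h, f \in Lfun mu 2%:E -> h \in Lfun mu 2%:E ->
    generator f h <->
    (forall g k, generator g k ->
       (\int[mu]_x (f x * k x)%:E = \int[mu]_x (h x * g x)%:E)%E).

End dirichlet_form.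

(* Elements of A0 and A are functions, not classes modulo mu.  Equalities and
   inequalities between functions are mu-a.e., apart from the range of the
   cut-offs xi_k and [Gamma_eq0_cst], which are pointwise.  One operator Gamma
   and one operator L serve both for A0 and for its extension to A.
   Integrals are extended-real valued: an equation equating an integral to a
   finite one forces integrability. *)
Record diffusion_markov_triple (R : realType) (X : ptopologicalType)
    (mu : {measure set (borel X) -> \bar R}) := DiffusionMarkovTriple {
  A0 : set (X -> R) ;
  A : set (X -> R) ;
  Gamma : (X -> R) -> (X -> R) -> X -> R ;
  L : (X -> R) -> X -> R ;

  A0_L1 : forall f, A0 f -> f \in Lfun mu 1%:E ;
  A0_lin : forall (a : R) f g, A0 f -> A0 g -> A0 (fun x => a * f x + g x) ;
  A0_0 : A0 (fun=> 0) ;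
  A0_dense : forall p : R, 1 <= p ->
    (forall f, A0 f -> f \in Lfun mu p%:E) /\
    (forall f, f \in Lfun mu p%:E -> forall e : R, 0 < e ->
       exists2 g, A0 g & (Lnorm mu p%:E (EFin \o (f \- g)%R) < e%:E)%E) ;
  A0_mul : forall f g, A0 f -> A0 g -> A0 (fun x => f x * g x) ;
  A0_smooth : forall (k : nat) (Psi : 'rV[R]_k -> R) (f : 'I_k -> X -> R),
    smooth Psi -> Psi 0 = 0 -> (forall i, A0 (f i)) ->
    A0 (Psi \o row_at f) ;

  Gamma_A0 : forall f g, A0 f -> A0 g -> A0 (Gamma f g) ;
  Gamma_sym : forall f g, A0 f -> A0 g ->
    {ae mu, forall x, Gamma f g x = Gamma g f x} ;
  Gamma_lin : forall (a : R) f g h, A0 f -> A0 g -> A0 h ->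
    {ae mu, forall x, Gamma (fun y => a * f y + g y) h x =
                      a * Gamma f h x + Gamma g h x} ;
  Gamma_ge0 : forall f, A0 f -> {ae mu, forall x, 0 <= Gamma f f x} ;
  Gamma_chain : forall (k : nat) (Psi : 'rV[R]_k -> R) (f : 'I_k -> X -> R) g,
    smooth Psi -> Psi 0 = 0 -> (forall i, A0 (f i)) -> A0 g ->
    {ae mu, forall x, Gamma (Psi \o row_at f) g x =
       \sum_i partial i Psi (row_at f x) * Gamma (f i) g x} ;

  energy_bounded : forall f, A0 f -> exists2 C : R, 0 < C &
    forall g, A0 g ->
      (`| \int[mu]_x (Gamma f g x)%:E | <= C%:E * Lnorm mu 2%:E (EFin \o g))%E ;

  L_lin : forall (a : R) f g, A f -> A g ->
    {ae mu, forall x, L (fun y => a * f y + g y) x = a * L f x + L g x} ;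
  L_A0 : forall f g, A0 f -> A0 g ->
    (\int[mu]_x (g x * L f x)%:E = - \int[mu]_x (Gamma f g x)%:E)%E ;
  L_self_adjoint : generator_self_adjoint mu A0 Gamma ;

  cutoffs : exists xi : nat -> X -> R,
    [/\ forall k, (0 < k)%N -> A0 (xi k) /\ forall x, 0 <= xi k x <= 1,
        forall k, (0 < k)%N -> {ae mu, forall x, xi k x <= xi k.+1 x},
        {ae mu, forall x, xi k x @[k --> \oo] --> (1 : R)} &
        forall k, (0 < k)%N ->
          {ae mu, forall x, Gamma (xi k) (xi k) x <= k%:R^-1}] ;

  A0_sub_A : A0 `<=` A ;
  A_measurable : forall f, A f -> measurable_fun [set: borel X] f ;
  A_cst : forall c : R, A (fun=> c) ;
  A_lin : forall (a : R) f g, A f -> A g -> A (fun x => a * f x + g x) ;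
  A_mul : forall f g, A f -> A g -> A (fun x => f x * g x) ;

  A_mul_A0 : forall f h, A f -> A0 h -> A0 (fun x => h x * f x) ;
  A_ge0 : forall f, A f ->
    (forall h, A0 h -> {ae mu, forall x, 0 <= h x} ->
       (0 <= \int[mu]_x (h x * f x)%:E)%E) ->
    {ae mu, forall x, 0 <= f x} ;
  A_smooth : forall (k : nat) (Psi : 'rV[R]_k -> R) (f : 'I_k -> X -> R),
    smooth Psi -> Psi 0 = 0 -> (forall i, A (f i)) ->
    A (Psi \o row_at f) ;
  A_Gamma_chain :
    forall (k : nat) (Psi : 'rV[R]_k -> R) (f : 'I_k -> X -> R) g,
    smooth Psi -> Psi 0 = 0 -> (forall i, A (f i)) -> A g ->
    {ae mu, forall x, Gamma (Psi \o row_at f) g x =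
       \sum_i partial i Psi (row_at f x) * Gamma (f i) g x} ;
  L_A : forall f, A f -> A (L f) ;
  Gamma_A : forall f g, A f -> A g -> A (Gamma f g) ;
  GammaE : forall f g, A f -> A g ->
    {ae mu, forall x, Gamma f g x =
       2^-1 * (L (fun y => f y * g y) x - f x * L g x - g x * L f x)} ;
  A_Gamma_ge0 : forall f, A f -> {ae mu, forall x, 0 <= Gamma f f x} ;
  A_ibp : forall f g, A f -> A0 g ->
    (\int[mu]_x (Gamma f g x)%:E = - \int[mu]_x (g x * L f x)%:E)%E /\
    (\int[mu]_x (Gamma f g x)%:E = - \int[mu]_x (f x * L g x)%:E)%E ;
  Gamma_eq0_cst : forall f, A f -> (forall x, Gamma f f x = 0) ->
    exists c : R, forall x, f x = c
}.

Definition Gamma2 (R : realType) (X : ptopologicalType)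
    (mu : {measure set (borel X) -> \bar R}) (M : diffusion_markov_triple mu)
    (f g : X -> R) : X -> R :=
  fun x => 2^-1 * (L M (Gamma M f g) x - Gamma M f (L M g) x
                   - Gamma M g (L M f) x).

Definition curvature_dimension (R : realType) (X : ptopologicalType)
    (mu : {measure set (borel X) -> \bar R}) (M : diffusion_markov_triple mu)
    (K : R) : Prop :=
  forall f, A M f -> {ae mu, forall x, K * Gamma M f f x <= Gamma2 M f f x}.

Definition weak_solution (R : realType) (X : ptopologicalType)
    (mu : {measure set (borel X) -> \bar R}) (M : diffusion_markov_triple mu)
    (F : R -> R) (u : X -> R) : Prop :=
  A M u /\ forall phi, A0 M phi ->
    (\int[mu]_x (Gamma M u phi x)%:E = \int[mu]_x (F (u x) * phi x)%:E)%E.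

Definition stable_solution (R : realType) (X : ptopologicalType)
    (mu : {measure set (borel X) -> \bar R}) (M : diffusion_markov_triple mu)
    (F : R -> R) (u : X -> R) : Prop :=
  weak_solution M F u /\ forall phi, A0 M phi ->
    (0 <= \int[mu]_x (Gamma M phi phi x)%:E
          - \int[mu]_x (derive1 F (u x) * phi x ^+ 2)%:E)%E.

(* Gamma (Gamma(u)^(1/2)), through the chain rule. *)
Definition Gamma_sqrt_Gamma (R : realType) (X : ptopologicalType)
    (mu : {measure set (borel X) -> \bar R}) (M : diffusion_markov_triple mu)
    (u : X -> R) : X -> R :=
  fun x => if Gamma M u u x == 0 then 0
    else Gamma M (Gamma M u u) (Gamma M u u) x / (4 * Gamma M u u x).

(* g is a version of the essential supremum of a (possibly uncountable) family
   S of functions: their least measurable upper bound modulo nu. *)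
Definition is_ess_supremum (d : measure_display) (T : measurableType d)
    (R : realType) (nu : {measure set T -> \bar R}) (S : set (T -> \bar R))
    (g : T -> \bar R) : Prop :=
  [/\ measurable_fun [set: T] g,
      forall f, S f -> {ae nu, forall z, (f z <= g z)%E} &
      forall h, measurable_fun [set: T] h ->
        (forall f, S f -> {ae nu, forall z, (f z <= h z)%E}) ->
        {ae nu, forall z, (g z <= h z)%E}].

(* The intrinsic distance is only determined modulo mu \x mu. *)
Definition is_intrinsic_distance (R : realType) (X : ptopologicalType)
    (mu : {sigma_finite_measure set (borel X) -> \bar R})
    (M : diffusion_markov_triple mu) (dist : X * X -> \bar R) : Prop :=
  is_ess_supremum (mu \x mu)%E
    [set D : borel X * borel X -> \bar R | exists f : X -> R,
       [/\ A M f, exists B : R, forall x, `|f x| <= B,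
           {ae mu, forall x, Gamma M f f x <= 1} &
           D = fun z => (f z.1 - f z.2)%:E]]
    dist.

(* Main.v *)
Require Import Defs.
From mathcomp Require Import all_boot all_order all_algebra.
From mathcomp Require Import all_classical all_reals all_analysis.
From mathcomp Require Import measurable_realfun ring lra.

(** Write g for Gamma(u) and G for Gamma(g^(1/2)) = Gamma(g) / (4 g).  All three
    conclusions follow from the vanishing of the gap Gamma2(u) - G
    ([stable_gap_eq0]), which is a competition between two inequalities.

    The curvature dimension condition improves itself to K g <= Gamma2(u) - G
    ([curvature_dimension_refined]).  It holds for every function
    a u + b g + u g; at almost every point it is therefore a polynomial
    inequality in a and b, and these may then be chosen at each point so that
    this function has there the differential of t u, while its second order
    part is t times that of u plus the symmetric product of du and dg.  What
    remains is a quadratic polynomial in t, and its discriminant is the improved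
    condition.

    In the other direction, a stable solution satisfies a geometric Poincare
    inequality ([stable_geometric_poincare]): the integral of
    xi^2 (Gamma2(u) - G) is at most the integral of Gamma(xi) g, for every xi
    in A0.  It comes from testing stability with xi g^(1/2) and from the
    identity Gamma2(u) = 1/2 L g + F'(u) g, the differentiated equation.  As
    the square root is not smooth at 0, it is replaced by
    psi(s) = (s^2 + e)^(1/4), smooth on the line.  Since psi'(s) is at most the
    derivative of the square root for s > 0, the energy of psi(g) is bounded by
    G with no error; the remaining errors are bounded by an integrable function
    uniformly in e, because A0 is an ideal of A contained in L^1, and vanish as
    e tends to 0.

    Along the cutoffs the energy density Gamma(xi_k) is at most 1/k, and g is
    integrable: the right-hand side tends to 0, so the gap, which is
    nonnegative, is 0 almost everywhere.  For K > 0 the improved condition then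
    gives g = 0 almost everywhere, hence everywhere when g is continuous, since
    mu charges every nonempty open set. *)

Set Implicit Arguments.
Unset Strict Implicit.
Unset Printing Implicit Defensive.

Import Order.TTheory GRing.Theory Num.Theory.
Import numFieldNormedType.Exports.

Local Open Scope classical_set_scope.
Local Open Scope ring_scope.

(** * Smooth functions of one real variable *)

Section smooth_functions.
Context (R : realType).
Implicit Types (h : R -> R) (p : {poly R}).

(** Coinduction principle: a class of functions stable under derivation consists
    of smooth functions.  It spares computing any higher derivative. *)
Lemma smooth1_closed (C : set (R -> R)) :
  (forall h, C h -> (forall x, derivable h x 1) /\ C (derive1 h)) ->
  forall h, C h -> smooth1 h.
Proof.
move=> HC h Ch n; elim: n h Ch => [|n IH] h /HC[dh Ch] x; first exact: dh.
by rewrite derive1Sn; exact: IH.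
Qed.

Lemma smooth1_derive1 h : smooth1 h -> smooth1 (derive1 h).
Proof. by move=> sh n x; rewrite -derive1Sn; exact: sh. Qed.

Lemma smooth1_horner p : smooth1 (horner p).
Proof.
apply: (@smooth1_closed (range (@horner R))); last by exists p.
move=> _ [q _ <-]; split=> [x|]; first exact: derivable_horner.
by rewrite -derivE; exists q^`().
Qed.

Lemma smooth1_is_derive h (x : R) : smooth1 h -> is_derive x 1 h (derive1 h x).
Proof. by move=> sh; apply: DeriveDef; [exact: (sh 0%N)|rewrite derive1E]. Qed.

Lemma is_deriveB_cst h (c x : R) : smooth1 h ->
  is_derive x 1 (fun s => h s - c) (derive1 h x).
Proof.
move=> sh; have dh := smooth1_is_derive x sh.
by apply: trigger_derive; rewrite subr0.
Qed.

Lemma derive1B_cst h c : smooth1 h -> derive1 (fun s => h s - c) = derive1 h.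
Proof.
move=> sh; apply/funext => x; rewrite [LHS]derive1E.
by have [_ ->] := is_deriveB_cst c x sh.
Qed.

Lemma smooth1B_cst h c : smooth1 h -> smooth1 (fun s => h s - c).
Proof.
move=> sh [|n] x; first by have [] := is_deriveB_cst c x sh.
by rewrite derive1Sn derive1B_cst//; exact: smooth1_derive1.
Qed.

(** A row vector of length one is its only entry, so difference quotients along
    the basis vector are those of the real variable; this carries the
    one-variable calculus over to functions on 'rV_1. *)
Lemma row_quotient h (i : 'I_1) (a : 'rV[R]_1) :
  (fun t : R => t^-1 *: (((fun v : 'rV[R]_1 => h (v 0 0)) \o shift a)
     (t *: delta_mx 0 i) - h (a 0 0))) =
  (fun t : R => t^-1 *: ((h \o shift (a 0 0)) (t *: 1 : R) - h (a 0 0))).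
Proof.
have -> : delta_mx 0 i = const_mx 1 :> 'rV[R]_1.
  by apply/rowP => j; rewrite !mxE !ord1.
by apply/funext => t /=; rewrite !mxE.
Qed.

Lemma partial_row h (i : 'I_1) :
  partial i (fun v : 'rV[R]_1 => h (v 0 0)) = fun v => derive1 h (v 0 0).
Proof.
by apply/funext => a; rewrite derive1E /partial /derive row_quotient.
Qed.

Lemma smooth1_row h : smooth1 h -> smooth (fun v : 'rV[R]_1 => h (v 0 0)).
Proof.
move=> sh s.
have -> : iter_partial s (fun v : 'rV[R]_1 => h (v 0 0)) =
    (fun v => derive1n (size s) h (v 0 0)).
  by elim: s => //= i s ->; rewrite partial_row.
split=> [a|i a]; last by rewrite /derivable row_quotient; exact: sh.
apply: (@continuous_comp _ _ _ (fun v : 'rV[R]_1 => v 0 0)).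
  exact: coord_continuous.
exact/differentiable_continuous/derivable1_diffP/sh.
Qed.

End smooth_functions.

(** * A smooth substitute for the square root *)

Section smooth_sqrt.
Context (R : realType).
Implicit Types e s : R.

(** The square root is not smooth at 0, and sqrt (s + e) is not defined on the
    whole line; this function is smooth on the line and tends to sqrt s for
    s >= 0 when e tends to 0.  Moreover its derivative is controlled by that of
    the square root, uniformly in e. *)
Definition smooth_sqrt (e s : R) : R := (s ^+ 2 + e) `^ 4^-1.

Lemma smooth_sqrt_arg_gt0 (e s : R) : 0 < e -> 0 < s ^+ 2 + e.
Proof. by move=> e0; rewrite ltr_wpDl// sqr_ge0. Qed.

Lemma smooth_sqrt_gt0 (e s : R) : 0 < e -> 0 < smooth_sqrt e s.
Proof. by move=> e0; rewrite powR_gt0// smooth_sqrt_arg_gt0. Qed.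

Lemma smooth_sqrtX4 (e s : R) : 0 < e -> smooth_sqrt e s ^+ 4 = s ^+ 2 + e.
Proof.
move=> e0; rewrite -powR_mulrn ?powR_ge0// -powRrM mulVf ?pnatr_eq0//.
by rewrite powRr1// ltW// smooth_sqrt_arg_gt0.
Qed.

(** The products of a polynomial and of a real power of s^2 + e form a class
    that is stable under derivation. *)
Lemma smooth1_smooth_sqrt (e : R) : 0 < e -> smooth1 (smooth_sqrt e).
Proof.
move=> e0.
pose C := [set h : R -> R | exists (p : {poly R}) (a : R),
  h = fun s => p.[s] * (s ^+ 2 + e) `^ a].
apply: (@smooth1_closed _ C); last first.
  by exists 1%:P, 4^-1; apply/funext => s; rewrite hornerC mul1r.
move=> _ [p [a ->]].
have D (s : R) : is_derive s 1 (fun s => p.[s] * (s ^+ 2 + e) `^ a)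
    ((p^`() * ('X^2 + e%:P) + (a *+ 2)%:P * 'X * p).[s]
       * (s ^+ 2 + e) `^ (a - 1)).
  have se := smooth_sqrt_arg_gt0 s e0.
  have dq : is_derive s 1 (fun s => s ^+ 2 + e) (s *+ 2).
    by apply: trigger_derive; rewrite addr0 /= /GRing.scale /= !mulr1 mulr2n.
  have da : is_derive s 1 (fun s => (s ^+ 2 + e) `^ a)
      (s *+ 2 * (a * (s ^+ 2 + e) `^ (a - 1))).
    have := @is_derive1_comp R (@powR R ^~ a) (fun s => s ^+ 2 + e) s _ _
      (@is_derive1_powR R a _ se) dq.
    by move/trigger_derive; apply; rewrite mulrC.
  have /trigger_derive := is_deriveM (is_derive_poly p s) da; apply.
  rewrite !hornerE /GRing.scale /=.
  have -> : (s ^+ 2 + e) `^ a = (s ^+ 2 + e) * (s ^+ 2 + e) `^ (a - 1).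
    rewrite -{2}[s ^+ 2 + e](powRr1 (ltW se)) -powRD; last first.
      by rewrite (gt_eqF se) implybT.
    by rewrite addrCA subrr addr0.
  by rewrite !mulr2n; ring.
split=> [x|]; first by have [] := D x.
eexists; exists (a - 1); apply/funext => x; rewrite derive1E.
by have [_ ->] := D x.
Qed.

(** With psi for smooth_sqrt e, this is half of the derivative of the equation
    psi^4 = s^2 + e. *)
Lemma smooth_sqrt_derive (e s : R) : 0 < e ->
  derive1 (smooth_sqrt e) s * smooth_sqrt e s * (2 * smooth_sqrt e s ^+ 2) = s.
Proof.
move=> e0.
have ds := smooth1_is_derive s (smooth1_smooth_sqrt e0).
have : is_derive s 1 (fun t => smooth_sqrt e t ^+ 4) (s *+ 2).
  have -> : (fun t => smooth_sqrt e t ^+ 4) = (fun t => t ^+ 2 + e).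
    by apply/funext => t; rewrite smooth_sqrtX4.
  by apply: trigger_derive; rewrite addr0 /= /GRing.scale /= !mulr1 mulr2n.
case=> _; rewrite derive_val /GRing.scale /= => E.
apply: (@mulIf _ 2) => //; lra.
Qed.

(** Equivalently, psi' is at most 1 / (2 sqrt s), because psi^2 >= s and
    2 psi^3 psi' = s.  This is what makes the energy of the regularised square
    root of Gamma(u) bounded by Gamma(Gamma(u)^(1/2)), without any limit. *)
Lemma smooth_sqrt_derive_bound (e s : R) : 0 < e -> 0 <= s ->
  derive1 (smooth_sqrt e) s ^+ 2 * (4 * s) <= 1.
Proof.
move=> e0 s0.
have := smooth_sqrt_derive s e0; have := smooth_sqrtX4 s e0.
have := smooth_sqrt_gt0 s e0.
move: (smooth_sqrt e s) (derive1 (smooth_sqrt e) s) => p d p0 p4 dp.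
have sp : s <= p ^+ 2.
  by rewrite -(@ler_pXn2r _ 2)// ?nnegrE ?sqr_ge0// -exprM p4 lerDl ltW.
rewrite -(@ler_pM2r _ (p ^+ 6)) ?exprn_gt0// mul1r.
have -> : d ^+ 2 * (4 * s) * p ^+ 6 = s * (d * p * (2 * p ^+ 2)) ^+ 2 by ring.
by rewrite dp -exprS (exprM p 2 3) lerXn2r// nnegrE ?sqr_ge0.
Qed.

(** With p = smooth_sqrt (e^2) s and d its derivative, 2 p d is s / p^2 and
    p^4 = s^2 + e^2 gives s <= p^2 <= s + e.  The middle bound says that 2 p d
    tends to 1 for s > 0; the first one keeps it bounded near s = 0, where it
    does not. *)
Lemma smooth_sqrt_bounds (e s : R) : 0 < e -> 0 <= s ->
  let p := smooth_sqrt (e ^+ 2) s in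
  let d := derive1 (smooth_sqrt (e ^+ 2)) s in
  [/\ -1 <= 2 * (p * d) - 1 <= 0, (1 - 2 * (p * d)) * s <= e &
      0 <= p ^+ 2 - s <= e].
Proof.
move=> e0 s0 p d; have ee0 : 0 < e ^+ 2 by rewrite exprn_gt0.
have := smooth_sqrt_derive s ee0; have := smooth_sqrtX4 s ee0.
have := smooth_sqrt_gt0 s ee0.
rewrite -/p -/d => p0 p4 dp; have pp0 : 0 < p ^+ 2 by rewrite exprn_gt0.
have sp : s <= p ^+ 2.
  by rewrite -(@ler_pXn2r _ 2)// ?nnegrE ?sqr_ge0// -exprM p4 lerDl ltW.
have pse : p ^+ 2 <= s + e.
  rewrite -(@ler_pXn2r _ 2)// ?nnegrE ?sqr_ge0 ?addr_ge0 ?(ltW e0)//.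
  by rewrite -exprM p4 sqrrD -addrA lerD2l lerDr mulrn_wge0// mulr_ge0// ltW.
have q1 : 2 * (p * d) <= 1.
  by rewrite -(ler_pM2r pp0) mul1r; move: sp; rewrite -dp; lra.
have q0 : 0 <= 2 * (p * d).
  by rewrite -(ler_pM2r pp0) mul0r; move: s0; rewrite -dp; lra.
split; [by lra| |by lra].
have : (1 - 2 * (p * d)) * s <= (1 - 2 * (p * d)) * p ^+ 2.
  by apply: ler_wpM2l => //; rewrite subr_ge0.
have -> : (1 - 2 * (p * d)) * p ^+ 2 = p ^+ 2 - d * p * (2 * p ^+ 2) by ring.
rewrite dp; lra.
Qed.

End smooth_sqrt.

(** * Integrals of almost everywhere ordered functions *)

Section almost_everywhere_integrals.
Context d (T : measurableType d) (R : realType)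
  (mu : {measure set T -> \bar R}).
Implicit Types f g : T -> R.

Local Notation integrable f := (mu.-integrable [set: T] (EFin \o f)).

Lemma ae_le_integrable f g : measurable_fun [set: T] f -> integrable g ->
  {ae mu, forall x, `|f x| <= g x} -> integrable f.
Proof.
move=> mf /integrableP[mg ig] fg; apply/integrableP; split.
  exact/measurable_EFinP.
apply: le_lt_trans ig; apply: ae_ge0_le_integral => //.
- by apply: measurableT_comp => //; exact/measurable_EFinP.
- exact: measurableT_comp.
- move: fg; apply: filterS => x fg _ /=.
  by rewrite lee_fin (le_trans fg)// ler_norm.
Qed.

Lemma ae_eq_Rintegral f g : measurable_fun [set: T] f ->
  measurable_fun [set: T] g -> {ae mu, forall x, f x = g x} ->
  \int[mu]_x f x = \int[mu]_x g x.
Proof.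
move=> mf mg fg; congr fine; apply: ae_eq_integral => //.
- exact/measurable_EFinP.
- exact/measurable_EFinP.
- by move: fg; apply: filterS => x ->.
Qed.

Lemma integrable_measurable f : integrable f -> measurable_fun [set: T] f.
Proof. by move=> /measurable_int /measurable_EFinP. Qed.

Lemma ae_le_Rintegral f g : integrable f -> integrable g ->
  {ae mu, forall x, f x <= g x} -> \int[mu]_x f x <= \int[mu]_x g x.
Proof.
move=> fi gi fg; rewrite -subr_ge0 -RintegralB//.
have mf := integrable_measurable fi; have mg := integrable_measurable gi.
rewrite (@ae_eq_Rintegral _ (fun x => `|g x - f x|)).
- exact: Rintegral_ge0.
- exact: measurable_funB.
- by apply: measurableT_comp => //; exact: measurable_funB.
- by move: fg; apply: filterS => x fg; rewrite ger0_norm// subr_ge0.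
Qed.

Lemma ae_ge0_integrable f : measurable_fun [set: T] f ->
  {ae mu, forall x, 0 <= f x} -> (\int[mu]_x (f x)%:E < +oo)%E -> integrable f.
Proof.
move=> mf f0 intf; have mEf : measurable_fun [set: T] (EFin \o f).
  exact/measurable_EFinP.
apply/integrableP; split=> //; rewrite (ae_eq_integral (EFin \o f))//.
  exact: measurableT_comp.
by move: f0; apply: filterS => x f0 _ /=; rewrite ger0_norm.
Qed.

Lemma ae_ge0_Rintegral_eq0 f : integrable f -> {ae mu, forall x, 0 <= f x} ->
  \int[mu]_x f x <= 0 -> {ae mu, forall x, f x = 0}.
Proof.
move=> fi f0 intf; have mf := integrable_measurable fi.
have fabs : {ae mu, forall x, f x = `|f x|}.
  by move: f0; apply: filterS => x f0; rewrite ger0_norm.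
have mabs : measurable_fun [set: T] (fun x => `|f x|).
  exact: measurableT_comp.
have iabs : integrable (fun x => `|f x|).
  by apply: (ae_le_integrable mabs (integrable_norm fi)); apply: nearW => x /=;
    rewrite normr_id.
have E : (\int[mu]_x `|(EFin \o f) x| = 0)%E.
  change (\int[mu]_x (EFin \o (fun x => `|f x|%R)) x = 0)%E.
  rewrite -[LHS]fineK; last exact: (integrable_fin_num _ iabs).
  congr (_%:E); apply/eqP; rewrite eq_le; apply/andP; split.
    have := ae_eq_Rintegral mf mabs fabs.
    by rewrite /Rintegral => <-.
  exact: Rintegral_ge0.
have mEf : measurable_fun [set: T] (EFin \o f) by exact/measurable_EFinP.
have [/(_ E) + _] := ae_eq_integral_abs mu measurableT mEf.
by apply: filterS => x /(_ I) [].
Qed.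

(** Writing x^-1 as x (x^2)^(-1) reduces to a power of a nonnegative number. *)
Lemma measurable_fun_inv : measurable_fun [set: R] (fun x : R => x^-1).
Proof.
have -> : (fun x : R => x^-1) = (fun x => x * (x ^+ 2) `^ (-1)).
  apply/funext => x; rewrite powR_inv1 ?sqr_ge0//.
  have [->|x0] := eqVneq x 0; first by rewrite invr0 mul0r.
  by field.
apply: measurable_funM => //.
have := measurableT_comp (@measurable_powR R (-1))
  (measurable_funX 2 (@measurable_id _ R [set: R])).
exact.
Qed.

Lemma Rintegral_cvg0_dominated (f_ : nat -> T -> R) g :
  (forall n, measurable_fun [set: T] (f_ n)) -> integrable g ->
  {ae mu, forall x, f_ n x @[n --> \oo] --> 0} ->
  {ae mu, forall x, forall n, `|f_ n x| <= g x} ->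
  \int[mu]_x f_ n x @[n --> \oo] --> 0.
Proof.
move=> mf ig f0 fg.
have [] := @dominated_convergence _ _ _ mu _ measurableT
  (fun n => EFin \o f_ n) (cst 0%E) (EFin \o g) _ _ _ ig _.
- by move=> n; exact/measurable_EFinP.
- exact: measurable_cst.
- move: f0; apply: filterS => x f0 _ /=.
  exact: (@cvg_comp _ _ _ _ EFin _ _ _ f0).
- by move: fg; apply: filterS => x fg n _; rewrite lee_fin.
move=> _ _; rewrite integral0 => H.
by have /fine_cvgP[] := H.
Qed.

End almost_everywhere_integrals.

(** * Nonnegative quadratic polynomials *)

Section quadratic.
Context (R : realType).
Implicit Types a b c t : R.

Lemma quadratic_ge0_rat (a b c : R) :
  (forall q : rat, 0 <= a * ratr q ^+ 2 + b * ratr q + c) ->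
  forall t, 0 <= a * t ^+ 2 + b * t + c.
Proof.
move=> H t; rewrite leNgt; apply/negP => neg.
pose p : R -> R := fun s => a * s ^+ 2 + b * s + c.
have cp : continuous p.
  move=> s; apply: cvgD; last exact: cvg_cst.
  apply: cvgD; apply: cvgM; [exact: cvg_cst| |exact: cvg_cst|exact: cvg_id].
  exact: exprn_continuous.
have : open (p @^-1` [set y | y < 0]) by apply: open_comp => // y _; exact: cp.
have pt : p @^-1` [set y | y < 0] !=set0 by exists t.
move=> /(@dense_rat R _ pt) [s [/= ps [q _ qs]]].
by move: ps; rewrite -qs /p ltNge H.
Qed.

Lemma quadratic_ge0_discriminant (a b c : R) :
  (forall t, 0 <= a * t ^+ 2 + 2 * b * t + c) -> b ^+ 2 <= a * c.
Proof.
move=> Q; have := @deg_le2_poly_ge0 _ (Poly [:: c; 2 * b; a]) (size_Poly _).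
rewrite !coef_Poly /= => H.
suff /H : forall t, 0 <= (Poly [:: c; 2 * b; a]).[t] by lra.
by move=> t; rewrite horner_Poly /=; have := Q t; congr (_ <= _); ring.
Qed.

End quadratic.

(** * Calculus of Gamma and L modulo null sets *)

Section markov_triple.
Context (R : realType) (X : ptopologicalType)
  (mu : {measure set (borel X) -> \bar R}) (M : diffusion_markov_triple mu).
Implicit Types (f g h u xi phi : X -> R) (a b c : R).

Local Notation A0 := (A0 M).
Local Notation A := (A M).
Local Notation Gamma := (Gamma M).
Local Notation L := (L M).
Local Notation Gamma2 := (Gamma2 M).
Local Notation integrable f := (mu.-integrable [set: borel X] (EFin \o f)).

#[local] Instance ae_filter_borel : Filter (nbhs (almost_everywhere mu)).
Proof. exact: ae_filter_ringOfSetsType. Qed.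

(** Chaining this lemma collects almost everywhere identities one at a time, so
    that a computation can end pointwise. *)
Lemma ae_mp (P Q : X -> Prop) : {ae mu, forall x, P x} ->
  {ae mu, forall x, P x -> Q x} -> {ae mu, forall x, Q x}.
Proof. by apply: filterS2 => x Px; apply. Qed.

Lemma ae_all (P : X -> Prop) : (forall x, P x) -> {ae mu, forall x, P x}.
Proof. by move=> allP; apply: filterS filterT => x _. Qed.

Lemma ae_forall_countable (T : countType) (P : T -> X -> Prop) :
  (forall i, {ae mu, forall x, P i x}) -> {ae mu, forall x, forall i, P i x}.
Proof.
move=> HP.
have : {ae mu, forall x, forall n : nat,
    if unpickle n is Some i then P i x else True}.
  apply: ae_foralln => n; case: (unpickle n) => [i|]; first exact: HP.
  exact: ae_all.
apply: filterS => x H i; have := H (pickle i).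
by rewrite pickleK.
Qed.

Lemma A0_integrable f : A0 f -> mu.-integrable [set: borel X] (EFin \o f).
Proof. by move=> /A0_L1 /Lfun1_integrable. Qed.

Lemma A_measurable_fun f : A f -> measurable_fun [set: borel X] f.
Proof. exact: A_measurable. Qed.

Lemma A0D f g : A0 f -> A0 g -> A0 (fun x => f x + g x).
Proof.
move=> Af Ag; have := A0_lin 1 Af Ag.
by under eq_fun do rewrite mul1r.
Qed.

Lemma AD f g : A f -> A g -> A (fun x => f x + g x).
Proof.
move=> Af Ag; have := A_lin 1 Af Ag.
by under eq_fun do rewrite mul1r.
Qed.

Lemma AZ a f : A f -> A (fun x => a * f x).
Proof.
move=> Af; have := A_lin a Af (A_cst M 0).
by under eq_fun do rewrite addr0.
Qed.

Lemma AN f : A f -> A (fun x => - f x).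
Proof. by move=> /(AZ (-1)); under eq_fun do rewrite mulN1r. Qed.

Lemma AB f g : A f -> A g -> A (fun x => f x - g x).
Proof. by move=> Af Ag; apply: AD => //; exact: AN. Qed.

(** The positivity axiom [A_ge0], applied to f and to - f, lets the functions of
    A0 separate the elements of A modulo null sets. *)
Lemma ae_eq0_of_tests f : A f ->
  (forall h, A0 h -> (\int[mu]_x (h x * f x)%:E = 0)%E) ->
  {ae mu, forall x, f x = 0}.
Proof.
move=> Af f0.
have fge0 : {ae mu, forall x, 0 <= f x}.
  by apply: (A_ge0 Af) => h A0h _; rewrite f0.
have fle0 : {ae mu, forall x, 0 <= - f x}.
  apply: (A_ge0 (AN Af)) => h A0h _.
  under eq_integral do rewrite -mulN1r mulrCA EFinM.
  rewrite integralZl//; last exact: A0_integrable (A_mul_A0 Af A0h).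
  by rewrite f0// mule0.
move: fge0 fle0; apply: filterS2 => x f0x; rewrite oppr_ge0 => fx0.
by apply/eqP; rewrite eq_le fx0.
Qed.

(** L acts on functions, not on classes; integrating by parts twice, the
    integral of h L f is that of f L h, so L f is tested to 0 when f is null. *)
Lemma L_ae_eq0 f : A f -> {ae mu, forall x, f x = 0} ->
  {ae mu, forall x, L f x = 0}.
Proof.
move=> Af f0; apply: ae_eq0_of_tests; first exact: L_A.
move=> h A0h; have [-> ] := A_ibp Af A0h.
move/oppe_inj => ->; rewrite (ae_eq_integral (cst 0%E))//.
- exact: integral0.
- apply/measurable_EFinP; apply: measurable_funM.
    exact: (A_measurable Af).
  by apply: (@A_measurable _ _ _ M); apply: L_A; exact: A0_sub_A.
- by move: f0; apply: filterS => x -> _; rewrite mul0r.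
Qed.

Lemma L_ae_eq f g : A f -> A g -> {ae mu, forall x, f x = g x} ->
  {ae mu, forall x, L f x = L g x}.
Proof.
move=> Af Ag fg.
have := L_ae_eq0 (A_lin (-1) Ag Af).
have /[swap] /[apply] : {ae mu, forall x, -1 * g x + f x = 0}.
  by move: fg; apply: filterS => x ->; rewrite mulN1r addNr.
move: (L_lin (-1) Ag Af); apply: filterS2 => x -> /eqP.
by rewrite mulN1r addrC subr_eq0 => /eqP.
Qed.

Lemma GammaC f g : A f -> A g ->
  {ae mu, forall x, Gamma f g x = Gamma g f x}.
Proof.
move=> Af Ag; move: (GammaE Af Ag) (GammaE Ag Af).
apply: filterS2 => x -> ->; congr (_ * _).
by under [in RHS]eq_fun do rewrite mulrC; rewrite addrAC.
Qed.

Lemma Gamma_linear a f g h : A f -> A g -> A h ->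
  {ae mu, forall x, Gamma (fun y => a * f y + g y) h x =
                    a * Gamma f h x + Gamma g h x}.
Proof.
move=> Af Ag Ah.
apply: (ae_mp (GammaE (A_lin a Af Ag) Ah)).
apply: (ae_mp (GammaE Af Ah)).
apply: (ae_mp (GammaE Ag Ah)).
apply: (ae_mp (L_lin a Af Ag)).
apply: (ae_mp (L_lin a (A_mul Af Ah) (A_mul Ag Ah))).
apply: ae_all => x E1 E2 -> -> ->; rewrite E2.
have -> : (fun y => (a * f y + g y) * h y) =
    (fun y => a * (f y * h y) + g y * h y).
  by apply/funext => y; rewrite mulrDl mulrA.
by rewrite E1; ring.
Qed.

Lemma Gamma_ae_eq f g h : A f -> A g -> A h -> {ae mu, forall x, f x = g x} ->
  {ae mu, forall x, Gamma f h x = Gamma g h x}.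
Proof.
move=> Af Ag Ah fg.
apply: (ae_mp (GammaE Af Ah)).
apply: (ae_mp (GammaE Ag Ah)).
apply: (ae_mp (L_ae_eq Af Ag fg)).
have : {ae mu, forall x, L (fun y => f y * h y) x = L (fun y => g y * h y) x}.
  apply: L_ae_eq; [exact: A_mul|exact: A_mul|].
  by move: fg; apply: filterS => x ->.
move=> E; apply: (ae_mp E); apply: (ae_mp fg).
by apply: ae_all => x fgx E1 E2 -> ->; rewrite E1 E2 fgx.
Qed.

Lemma A_smooth1_eq0 (psi : R -> R) f : smooth1 psi -> psi 0 = 0 -> A f ->
  A (fun x => psi (f x)).
Proof.
move=> spsi psi0 Af.
have := @A_smooth _ _ _ M 1 _ (fun=> f) (smooth1_row spsi).
have -> : (fun v : 'rV[R]_1 => psi (v 0 0)) \o row_at (fun=> f) =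
    (fun x => psi (f x)) by apply/funext => x /=; rewrite mxE.
by apply; rewrite ?mxE.
Qed.

Lemma Gamma_chain1_eq0 (psi : R -> R) f g : smooth1 psi -> psi 0 = 0 ->
  A f -> A g ->
  {ae mu, forall x, Gamma (fun y => psi (f y)) g x =
                    derive1 psi (f x) * Gamma f g x}.
Proof.
move=> spsi psi0 Af Ag.
have := @A_Gamma_chain _ _ _ M 1 _ (fun=> f) g (smooth1_row spsi).
have -> : (fun v : 'rV[R]_1 => psi (v 0 0)) \o row_at (fun=> f) =
    (fun x => psi (f x)) by apply/funext => x /=; rewrite mxE.
rewrite mxE => /(_ psi0 (fun=> Af) Ag); apply: filterS => x ->.
by rewrite big_ord1 partial_row mxE.
Qed.

Lemma Gamma_sqr f g : A f -> A g ->
  {ae mu, forall x, Gamma (fun y => f y * f y) g x = 2 * f x * Gamma f g x}.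
Proof.
move=> Af Ag.
have E : (fun s => s * s) = horner ('X * 'X : {poly R}).
  by apply/funext => s; rewrite hornerM hornerX.
have := @Gamma_chain1_eq0 (horner ('X * 'X)) f g (@smooth1_horner _ _).
rewrite -derivE -E derivM derivX mul0r => /(_ erefl Af Ag).
by apply: filterS => x ->; rewrite !hornerE; ring.
Qed.

(** Polarisation of the chain rule for the square: only one-variable smooth
    functions have to be considered. *)
Lemma Gamma_leibniz f g h : A f -> A g -> A h ->
  {ae mu, forall x, Gamma (fun y => f y * g y) h x =
                    f x * Gamma g h x + g x * Gamma f h x}.
Proof.
move=> Af Ag Ah.
have Aff := A_mul Af Af; have Agg := A_mul Ag Ag; have Afg := A_mul Af Ag.
apply: (ae_mp (Gamma_sqr Af Ah)).
apply: (ae_mp (Gamma_sqr Ag Ah)).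
apply: (ae_mp (Gamma_sqr (A_lin 1 Af Ag) Ah)).
apply: (ae_mp (Gamma_linear 1 Af Ag Ah)).
apply: (ae_mp (Gamma_linear 2 Afg (A_lin 1 Aff Agg) Ah)).
apply: (ae_mp (Gamma_linear 1 Aff Agg Ah)).
apply: ae_all => x E1 E2 E3.
have -> : (fun y => (1 * f y + g y) * (1 * f y + g y)) =
    (fun y => 2 * (f y * g y) + (1 * (f y * f y) + g y * g y)).
  by apply/funext => y; ring.
rewrite E2 E1 E3 => E4 E5 E6; move: E4; rewrite E5 E6 => E4.
lra.
Qed.

Lemma Gamma_cst c h : A h -> {ae mu, forall x, Gamma (fun=> c) h x = 0}.
Proof.
move=> Ah; have Ac := A_cst M.
(* 1 * 1 = 1 gives Gamma(1, h) = 2 Gamma(1, h). *)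
apply: (ae_mp (Gamma_linear c (Ac 1) (Ac 0) Ah)).
apply: (ae_mp (Gamma_leibniz (Ac 1) (Ac 1) Ah)).
apply: (ae_mp (Gamma_leibniz (Ac 0) (Ac 0) Ah)).
apply: ae_all => x; rewrite !mulr1 !mul1r !mulr0 !mul0r addr0 => -> G1.
rewrite addr0 => ->; have -> : Gamma (fun=> 1) h x = 0 by lra.
by rewrite mulr0 addr0.
Qed.

(** Constants are invisible to Gamma, which removes the normalisation
    psi 0 = 0 of the axiom. *)
Lemma Gamma_chain1 (psi : R -> R) f g : smooth1 psi -> A f -> A g ->
  {ae mu, forall x, Gamma (fun y => psi (f y)) g x =
                    derive1 psi (f x) * Gamma f g x}.
Proof.
move=> spsi Af Ag; have spsi0 := smooth1B_cst spsi (c := psi 0).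
have Apsi := A_smooth1_eq0 spsi0 (subrr _) Af.
apply: (ae_mp (Gamma_chain1_eq0 spsi0 (subrr _) Af Ag)).
apply: (ae_mp (Gamma_linear 1 Apsi (A_cst M (psi 0)) Ag)).
apply: (ae_mp (Gamma_cst (psi 0) Ag)).
apply: ae_all => x E1.
have -> : (fun y => 1 * (psi (f y) - psi 0) + psi 0) = (fun y => psi (f y)).
  by apply/funext => y; rewrite mul1r subrK.
by rewrite derive1B_cst// E1 => -> ->; rewrite addr0 mul1r.
Qed.

Lemma A_smooth1 (psi : R -> R) f : smooth1 psi -> A f ->
  A (fun x => psi (f x)).
Proof.
move=> spsi Af.
have := AD (A_smooth1_eq0 (smooth1B_cst spsi (c := psi 0)) (subrr _) Af)
           (A_cst M (psi 0)).
by under eq_fun do rewrite subrK.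
Qed.

Lemma L_leibniz f g : A f -> A g ->
  {ae mu, forall x, L (fun y => f y * g y) x =
                    f x * L g x + g x * L f x + 2 * Gamma f g x}.
Proof.
by move=> Af Ag; move: (GammaE Af Ag); apply: filterS => x ->; field.
Qed.

Lemma LD f g : A f -> A g ->
  {ae mu, forall x, L (fun y => f y + g y) x = L f x + L g x}.
Proof.
move=> Af Ag; apply: (ae_mp (L_lin 1 Af Ag)); apply: ae_all => x.
by under eq_fun do rewrite mul1r; rewrite mul1r.
Qed.

Lemma GammaD f g h : A f -> A g -> A h ->
  {ae mu, forall x, Gamma (fun y => f y + g y) h x =
                    Gamma f h x + Gamma g h x}.
Proof.
move=> Af Ag Ah; apply: (ae_mp (Gamma_linear 1 Af Ag Ah)); apply: ae_all => x.
by under eq_fun do rewrite mul1r; rewrite mul1r.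
Qed.

Lemma GammaZ a f h : A f -> A h ->
  {ae mu, forall x, Gamma (fun y => a * f y) h x = a * Gamma f h x}.
Proof.
move=> Af Ah; apply: (ae_mp (Gamma_linear a Af (A_cst M 0) Ah)).
apply: (ae_mp (Gamma_cst 0 Ah)); apply: ae_all => x ->.
by under eq_fun do rewrite addr0; rewrite addr0.
Qed.

Lemma Gamma_ae_eqr f g h : A f -> A g -> A h -> {ae mu, forall x, f x = g x} ->
  {ae mu, forall x, Gamma h f x = Gamma h g x}.
Proof.
move=> Af Ag Ah fg.
apply: (ae_mp (GammaC Ah Af)); apply: (ae_mp (GammaC Ah Ag)).
apply: (ae_mp (Gamma_ae_eq Af Ag Ah fg)).
by apply: ae_all => x -> -> ->.
Qed.

Lemma Gamma_leibnizr f g h : A f -> A g -> A h ->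
  {ae mu, forall x, Gamma h (fun y => f y * g y) x =
                    f x * Gamma h g x + g x * Gamma h f x}.
Proof.
move=> Af Ag Ah; apply: (ae_mp (GammaC Ah Af)); apply: (ae_mp (GammaC Ah Ag)).
apply: (ae_mp (GammaC Ah (A_mul Af Ag))).
apply: (ae_mp (Gamma_leibniz Af Ag Ah)).
by apply: ae_all => x -> -> -> ->.
Qed.

Lemma GammaDr f g h : A f -> A g -> A h ->
  {ae mu, forall x, Gamma h (fun y => f y + g y) x =
                    Gamma h f x + Gamma h g x}.
Proof.
move=> Af Ag Ah; apply: (ae_mp (GammaC Ah Af)); apply: (ae_mp (GammaC Ah Ag)).
apply: (ae_mp (GammaC Ah (AD Af Ag))).
apply: (ae_mp (GammaD Af Ag Ah)).
by apply: ae_all => x -> -> -> ->.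
Qed.

(** * Self-improvement of the curvature dimension condition *)

Definition ae_bilinear (B : (X -> R) -> (X -> R) -> X -> R) : Prop :=
  (forall f g, A f -> A g -> {ae mu, forall x, B f g x = B g f x}) /\
  (forall a f g h, A f -> A g -> A h ->
    {ae mu, forall x, B (fun y => a * f y + g y) h x = a * B f h x + B g h x}).

Lemma Gamma_bilinear : ae_bilinear Gamma.
Proof.
by split=> [f g|a f g h]; [exact: GammaC|exact: Gamma_linear].
Qed.

Lemma Gamma2_bilinear : ae_bilinear Gamma2.
Proof.
split=> [f g Af Ag|a f g h Af Ag Ah].
  apply: (ae_mp (L_ae_eq (Gamma_A Af Ag) (Gamma_A Ag Af) (GammaC Af Ag))).
  by apply: ae_all => x E; rewrite /Defs.Gamma2 E addrAC.
have Alin := A_lin a Af Ag.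
have [ALf ALg ALh] := And3 (L_A Af) (L_A Ag) (L_A Ah).
have [Afh Agh] := conj (Gamma_A Af Ah) (Gamma_A Ag Ah).
apply: (ae_mp (L_ae_eq (Gamma_A Alin Ah) (A_lin a Afh Agh)
  (Gamma_linear a Af Ag Ah))).
apply: (ae_mp (L_lin a Afh Agh)).
apply: (ae_mp (Gamma_linear a Af Ag ALh)).
apply: (ae_mp (GammaC Ah (L_A Alin))).
apply: (ae_mp (Gamma_ae_eq (L_A Alin) (A_lin a ALf ALg) Ah (L_lin a Af Ag))).
apply: (ae_mp (Gamma_linear a ALf ALg Ah)).
apply: (ae_mp (GammaC ALf Ah)).
apply: (ae_mp (GammaC ALg Ah)).
apply: ae_all => x E1 E2 E3 E4 E5 E6 E7 E8.
by rewrite /Defs.Gamma2 E8 E7 E6 E5 E4 E3 E2 E1; ring.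
Qed.

Lemma ae_bilinearB_scale B1 B2 c : ae_bilinear B1 -> ae_bilinear B2 ->
  ae_bilinear (fun f g x => B1 f g x - c * B2 f g x).
Proof.
move=> [s1 l1] [s2 l2]; split=> [f g Af Ag|a f g h Af Ag Ah].
  apply: (ae_mp (s1 _ _ Af Ag)); apply: (ae_mp (s2 _ _ Af Ag)).
  by apply: ae_all => x -> ->.
apply: (ae_mp (l1 a _ _ _ Af Ag Ah)); apply: (ae_mp (l2 a _ _ _ Af Ag Ah)).
by apply: ae_all => x -> ->; ring.
Qed.

(** The last bracket is twice the Hessian of h evaluated at (f, g), so Gamma2
    fails to be a derivation by second order terms only. *)
Lemma Gamma2_leibniz f g h : A f -> A g -> A h ->
  {ae mu, forall x, Gamma2 (fun y => f y * g y) h x =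
    f x * Gamma2 g h x + g x * Gamma2 f h x +
    (Gamma f (Gamma g h) x + Gamma g (Gamma f h) x - Gamma h (Gamma f g) x)}.
Proof.
move=> Af Ag Ah; have Afg := A_mul Af Ag.
have [ALf ALg ALh] := And3 (L_A Af) (L_A Ag) (L_A Ah).
have [Gfh Ggh Gfg] := And3 (Gamma_A Af Ah) (Gamma_A Ag Ah) (Gamma_A Af Ag).
have [P1 P2] := conj (A_mul Af Ggh) (A_mul Ag Gfh).
have [P3 P4] := conj (A_mul Af ALg) (A_mul Ag ALf).
apply: (ae_mp (L_ae_eq (Gamma_A Afg Ah) (AD P1 P2) (Gamma_leibniz Af Ag Ah))).
apply: (ae_mp (LD P1 P2)).
apply: (ae_mp (L_leibniz Af Ggh)); apply: (ae_mp (L_leibniz Ag Gfh)).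
apply: (ae_mp (Gamma_leibniz Af Ag ALh)).
apply: (ae_mp (Gamma_ae_eqr (L_A Afg) (AD (AD P3 P4) (AZ 2 Gfg)) Ah
  (L_leibniz Af Ag))).
apply: (ae_mp (GammaDr (AD P3 P4) (AZ 2 Gfg) Ah)).
apply: (ae_mp (GammaDr P3 P4 Ah)).
apply: (ae_mp (Gamma_leibnizr Af ALg Ah)).
apply: (ae_mp (Gamma_leibnizr Ag ALf Ah)).
apply: (ae_mp (GammaC Ah (AZ 2 Gfg))); apply: (ae_mp (GammaZ 2 Gfg Ah)).
apply: (ae_mp (GammaC Ah Gfg)).
apply: (ae_mp (GammaC Ah Af)); apply: (ae_mp (GammaC Ah Ag)).
apply: ae_all => x E1 E2 E3 E4 E5 E6 E7 E8 E9 E10 E11 E12 E13 E14 E15.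
rewrite /Defs.Gamma2 E15 E14 E13 E12 E11 E10 E9 E8 E7 E6 E5 E4 E3 E2 E1.
by field.
Qed.

(** Nonnegativity of B on each combination a f + b g + h gives, for almost every
    x, a polynomial inequality in (a, b).  The exceptional set depends on
    (a, b), so the inequality is first obtained for all rational a, b at once
    and then extended by continuity: afterwards a and b may depend on x. *)
Lemma ae_quadratic_form_ge0 B f g h : ae_bilinear B ->
  (forall k, A k -> {ae mu, forall x, 0 <= B k k x}) -> A f -> A g -> A h ->
  {ae mu, forall x, forall a b, 0 <= a ^+ 2 * B f f x + b ^+ 2 * B g g x +
    B h h x + 2 * a * b * B f g x + 2 * a * B f h x + 2 * b * B g h x}.
Proof.
move=> [BC Blin] B0 Af Ag Ah.
have : {ae mu, forall x, forall (q : rat * rat),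
    0 <= ratr q.1 ^+ 2 * B f f x + ratr q.2 ^+ 2 * B g g x + B h h x +
      2 * ratr q.1 * ratr q.2 * B f g x + 2 * ratr q.1 * B f h x +
      2 * ratr q.2 * B g h x}.
  apply: ae_forall_countable => -[q r] /=.
  set a : R := ratr q; set b : R := ratr r.
  have Agh := A_lin b Ag Ah; have Afgh := A_lin a Af Agh.
  apply: (ae_mp (B0 _ Afgh)); apply: (ae_mp (Blin a _ _ _ Af Agh Afgh)).
  apply: (ae_mp (Blin b _ _ _ Ag Ah Afgh)).
  apply: (ae_mp (BC _ _ Af Afgh)); apply: (ae_mp (BC _ _ Ag Afgh)).
  apply: (ae_mp (BC _ _ Ah Afgh)); apply: (ae_mp (Blin a _ _ _ Af Agh Af)).
  apply: (ae_mp (Blin a _ _ _ Af Agh Ag)).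
  apply: (ae_mp (Blin a _ _ _ Af Agh Ah)).
  apply: (ae_mp (Blin b _ _ _ Ag Ah Af)).
  apply: (ae_mp (Blin b _ _ _ Ag Ah Ag)).
  apply: (ae_mp (Blin b _ _ _ Ag Ah Ah)); apply: (ae_mp (BC _ _ Ag Af)).
  apply: (ae_mp (BC _ _ Ah Af)); apply: (ae_mp (BC _ _ Ah Ag)).
  apply: ae_all => x E1 E2 E3 E4 E5 E6 E7 E8 E9 E10 E11 E12 E13 E14.
  rewrite E14 E13 E12 E11 E10 E9 E8 E7 E6 E5 E4 E3 E2 E1.
  by congr (_ <= _); ring.
apply: filterS => x Q a b.
have -> : a ^+ 2 * B f f x + b ^+ 2 * B g g x + B h h x +
    2 * a * b * B f g x + 2 * a * B f h x + 2 * b * B g h x =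
    B f f x * a ^+ 2 + (2 * b * B f g x + 2 * B f h x) * a +
    (b ^+ 2 * B g g x + B h h x + 2 * b * B g h x) by ring.
apply: quadratic_ge0_rat => q.
have -> : B f f x * ratr q ^+ 2 + (2 * b * B f g x + 2 * B f h x) * ratr q +
    (b ^+ 2 * B g g x + B h h x + 2 * b * B g h x) =
    B g g x * b ^+ 2 + (2 * ratr q * B f g x + 2 * B g h x) * b +
    (ratr q ^+ 2 * B f f x + B h h x + 2 * ratr q * B f h x) by ring.
apply: quadratic_ge0_rat => r; have := Q (q, r) => /=.
by congr (_ <= _); ring.
Qed.

Lemma Gamma_cauchy_schwarz f g : A f -> A g ->
  {ae mu, forall x, Gamma f g x ^+ 2 <= Gamma f f x * Gamma g g x}.
Proof.
move=> Af Ag.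
apply: (ae_mp (ae_quadratic_form_ge0 Gamma_bilinear (@A_Gamma_ge0 _ _ _ M)
  Af Af Ag)).
apply: ae_all => x Q; apply: quadratic_ge0_discriminant => t.
by have := Q t 0; congr (_ <= _); ring.
Qed.

Lemma Gamma2_mull f g : A f -> A g ->
  {ae mu, forall x, Gamma2 f (fun y => f y * g y) x =
    f x * Gamma2 f g x + g x * Gamma2 f f x + Gamma g (Gamma f f) x}.
Proof.
move=> Af Ag; have [BC _] := Gamma2_bilinear.
apply: (ae_mp (BC _ _ Af (A_mul Af Ag))).
apply: (ae_mp (Gamma2_leibniz Af Ag Af)); apply: (ae_mp (BC _ _ Ag Af)).
apply: (ae_mp (Gamma_ae_eqr (Gamma_A Ag Af) (Gamma_A Af Ag) Af (GammaC Ag Af))).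
by apply: ae_all => x E1 E2 -> ->; rewrite E2 E1; ring.
Qed.

Lemma Gamma2_mulr f g : A f -> A g ->
  {ae mu, forall x, Gamma2 g (fun y => f y * g y) x =
    f x * Gamma2 g g x + g x * Gamma2 f g x + Gamma f (Gamma g g) x}.
Proof.
move=> Af Ag; have [BC _] := Gamma2_bilinear.
apply: (ae_mp (Gamma2_mull Ag Af)); apply: (ae_mp (BC _ _ Ag Af)).
under [fun y => f y * g y]eq_fun do rewrite mulrC.
by apply: ae_all => x -> ->; ring.
Qed.

Lemma Gamma2_mul_diag f g : A f -> A g ->
  {ae mu, forall x, Gamma2 (fun y => f y * g y) (fun y => f y * g y) x =
    f x ^+ 2 * Gamma2 g g x + g x ^+ 2 * Gamma2 f f x +
    2 * f x * g x * Gamma2 f g x +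
    2 * f x * Gamma f (Gamma g g) x + 2 * g x * Gamma g (Gamma f f) x +
    2 * (Gamma f f x * Gamma g g x + Gamma f g x ^+ 2)}.
Proof.
move=> Af Ag; have Afg := A_mul Af Ag.
have [Gff Ggg Gfg] := And3 (Gamma_A Af Af) (Gamma_A Ag Ag) (Gamma_A Af Ag).
have [P1 P2] := conj (A_mul Af Ggg) (A_mul Ag Gfg).
have [P3 P4] := conj (A_mul Af Gfg) (A_mul Ag Gff).
have E1 : {ae mu, forall x, Gamma g (fun y => f y * g y) x =
                            f x * Gamma g g x + g x * Gamma f g x}.
  apply: (ae_mp (Gamma_leibnizr Af Ag Ag)); apply: (ae_mp (GammaC Ag Af)).
  by apply: ae_all => x -> ->.
have E2 := Gamma_leibnizr Af Ag Af.
apply: (ae_mp (Gamma2_leibniz Af Ag Afg)).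
apply: (ae_mp (Gamma2_mull Af Ag)).
apply: (ae_mp (Gamma2_mulr Af Ag)).
apply: (ae_mp (Gamma_ae_eqr (Gamma_A Ag Afg) (AD P1 P2) Af E1)).
apply: (ae_mp (GammaDr P1 P2 Af)).
apply: (ae_mp (Gamma_leibnizr Af Ggg Af)).
apply: (ae_mp (Gamma_leibnizr Ag Gfg Af)).
apply: (ae_mp (Gamma_ae_eqr (Gamma_A Af Afg) (AD P3 P4) Ag E2)).
apply: (ae_mp (GammaDr P3 P4 Ag)).
apply: (ae_mp (Gamma_leibnizr Af Gfg Ag)).
apply: (ae_mp (Gamma_leibnizr Ag Gff Ag)).
apply: (ae_mp (GammaC Ag Af)).
apply: (ae_mp (Gamma_leibniz Af Ag Gfg)).
apply: ae_all => x F1 F2 F3 F4 F5 F6 F7 F8 F9 F10 F11 F12 ->.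
by rewrite F12 F11 F10 F9 F8 F7 F6 F5 F4 F3 F2 F1; ring.
Qed.

(** Put g = Gamma(f).  The condition, applied to a f + b g + f g, may be read at
    a point x with b = - f(x) and a = t - g(x): all the terms in which f or g is
    not differentiated cancel, and what remains is
    t^2 (Gamma2(f) - K g) + 2 t Gamma(g) + 2 (g Gamma(g) + Gamma(f, g)^2).
    By Cauchy-Schwarz the last term is at most 4 g Gamma(g), and the
    discriminant of the resulting polynomial in t is the claim multiplied by
    Gamma(g). *)
Lemma curvature_dimension_refined K f : curvature_dimension M K -> A f ->
  {ae mu, forall x, Gamma (Gamma f f) (Gamma f f) x <=
    4 * Gamma f f x * (Gamma2 f f x - K * Gamma f f x)}.
Proof.
move=> CD Af; set g := Gamma f f.
have Ag : A g by exact: Gamma_A.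
have Afg := A_mul Af Ag.
pose B := fun f g x => Gamma2 f g x - K * Gamma f g x.
have Bbil : ae_bilinear B.
  exact: ae_bilinearB_scale Gamma2_bilinear Gamma_bilinear.
have B0 k : A k -> {ae mu, forall x, 0 <= B k k x}.
  by move=> /CD; apply: filterS => x; rewrite subr_ge0.
apply: (ae_mp (ae_quadratic_form_ge0 Bbil B0 Af Ag Afg)).
apply: (ae_mp (Gamma2_mull Af Ag)).
apply: (ae_mp (Gamma2_mulr Af Ag)).
apply: (ae_mp (Gamma2_mul_diag Af Ag)).
apply: (ae_mp (Gamma_leibnizr Af Ag Af)).
apply: (ae_mp (Gamma_leibnizr Af Ag Ag)).
apply: (ae_mp (Gamma_leibniz Af Ag Afg)).
apply: (ae_mp (GammaC Ag Af)).
apply: (ae_mp (Gamma_cauchy_schwarz Af Ag)).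
apply: (ae_mp (A_Gamma_ge0 Af)).
apply: (ae_mp (A_Gamma_ge0 Ag)).
apply: (ae_mp (CD _ Af)).
apply: ae_all => x K0 gg0 g0 CS F1 F2 F3 F4 F5 F6 F7 Q.
have {}Q t : 0 <= (Gamma2 f f x - K * g x) * t ^+ 2 +
    2 * Gamma g g x * t + 4 * g x * Gamma g g x.
  have := Q (t - g x) (- f x).
  rewrite /B F7 F6 F5 F2 F3 F4 F1 -/g => Qt.
  apply: (le_trans Qt).
  suff : Gamma f g x ^+ 2 <= g x * Gamma g g x by nra.
  exact: CS.
have := quadratic_ge0_discriminant Q.
(* Where Gamma(g) = 0 the discriminant says nothing, but there the right-hand
   side is nonnegative. *)
have [->|gg_neq0] := eqVneq (Gamma g g x) 0.
  by move=> _; rewrite !mulr_ge0// subr_ge0.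
have pos : 0 < Gamma g g x by rewrite lt0r gg_neq0.
move=> H; rewrite -(ler_pM2r pos); move: H.
by congr (_ <= _); ring.
Qed.

(** On the set where Gamma(u) = 0 the convention 0^-1 = 0 gives the value 0. *)
Lemma Gamma_sqrt_GammaE u x :
  Gamma_sqrt_Gamma M u x = Gamma (Gamma u u) (Gamma u u) x / (4 * Gamma u u x).
Proof.
by rewrite /Gamma_sqrt_Gamma; case: eqP => // ->; rewrite mulr0 invr0 mulr0.
Qed.

Lemma measurable_Gamma_sqrt_Gamma u : A u ->
  measurable_fun [set: borel X] (Gamma_sqrt_Gamma M u).
Proof.
move=> Au; have Ag := Gamma_A Au Au.
have -> : Gamma_sqrt_Gamma M u =
    fun x => Gamma (Gamma u u) (Gamma u u) x / (4 * Gamma u u x).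
  by apply/funext => x; rewrite Gamma_sqrt_GammaE.
apply: measurable_funM; first exact: A_measurable_fun (Gamma_A Ag Ag).
apply: (measurableT_comp (@measurable_fun_inv R)).
exact: A_measurable_fun (AZ 4 Ag).
Qed.

Lemma Gamma_sqrt_Gamma_ge0 u : A u ->
  {ae mu, forall x, 0 <= Gamma_sqrt_Gamma M u x}.
Proof.
move=> Au; have Ag := Gamma_A Au Au.
apply: (ae_mp (A_Gamma_ge0 Au)); apply: (ae_mp (A_Gamma_ge0 Ag)).
apply: ae_all => x gg0 g0.
by rewrite Gamma_sqrt_GammaE divr_ge0// mulr_ge0.
Qed.

Lemma curvature_dimension_sqrt K u : curvature_dimension M K -> A u ->
  {ae mu, forall x, K * Gamma u u x <= Gamma2 u u x - Gamma_sqrt_Gamma M u x}.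
Proof.
move=> CD Au; apply: (ae_mp (curvature_dimension_refined CD Au)).
apply: (ae_mp (A_Gamma_ge0 Au)); apply: (ae_mp (CD _ Au)).
apply: ae_all => x CDx g0 H; rewrite Gamma_sqrt_GammaE.
move: g0; rewrite le_eqVlt => /orP[/eqP g0|g0].
  by rewrite -g0 !mulr0 invr0 !mulr0 subr0; move: CDx; rewrite -g0 mulr0.
by rewrite lerBrDl -lerBrDr ler_pdivrMr ?mulr_gt0// mulrC.
Qed.

(** Only the first term of Gamma(phi) is estimated.  The cross term, which has
    no sign, is kept exactly: it is to be cancelled by an integration by
    parts. *)
Lemma smooth_sqrt_cutoff_energy_le u xi (e : R) : 0 < e -> A u -> A0 xi ->
  let g := Gamma u u in
  let phi := fun x => xi x * smooth_sqrt e (g x) in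
  {ae mu, forall x, Gamma phi phi x <= xi x ^+ 2 * Gamma_sqrt_Gamma M u x +
    2 * (smooth_sqrt e (g x) * derive1 (smooth_sqrt e) (g x)) *
      (xi x * Gamma g xi x) +
    smooth_sqrt e (g x) ^+ 2 * Gamma xi xi x}.
Proof.
move=> e0 Au A0xi g phi; have Ag : A g by exact: Gamma_A.
have Axi := A0_sub_A A0xi.
have spsi := smooth1_smooth_sqrt e0.
have Apsi : A (fun x => smooth_sqrt e (g x)) := A_smooth1 spsi Ag.
have Aphi : A phi := A_mul Axi Apsi.
apply: (ae_mp (Gamma_leibniz Axi Apsi Aphi)).
apply: (ae_mp (Gamma_chain1 spsi Ag Aphi)).
apply: (ae_mp (Gamma_leibnizr Axi Apsi Ag)).
apply: (ae_mp (Gamma_leibnizr Axi Apsi Axi)).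
apply: (ae_mp (GammaC Ag Apsi)).
apply: (ae_mp (Gamma_chain1 spsi Ag Ag)).
apply: (ae_mp (GammaC Axi Apsi)).
apply: (ae_mp (Gamma_chain1 spsi Ag Axi)).
apply: (ae_mp (GammaC Ag Axi)).
apply: (ae_mp (A_Gamma_ge0 Au)); apply: (ae_mp (A_Gamma_ge0 Ag)).
apply: ae_all => x gg0 + E1 E2 E3 E4 E5 E6 E7 E8 E9; rewrite -/g => g0.
rewrite E9 E8 E7 E6 E5 E4 E3 E2 Gamma_sqrt_GammaE -/g.
rewrite E1.
have b := smooth_sqrt_derive_bound e0 g0.
have d0 := smooth_sqrt_derive (g x) e0.
have p0 := smooth_sqrt_gt0 (g x) e0.
have {b d0 p0} : derive1 (smooth_sqrt e) (g x) ^+ 2 * Gamma g g x <=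
    Gamma g g x / (4 * g x).
  move: g0; rewrite le_eqVlt => /orP[/eqP g0|g0].
    (* psi' vanishes at 0, and the right-hand side is 0 since 0^-1 = 0. *)
    have -> : derive1 (smooth_sqrt e) (g x) = 0.
      apply/eqP; move/eqP: d0; rewrite -/g -g0 mulf_eq0 mulf_eq0.
      rewrite (gt_eqF (smooth_sqrt_gt0 _ e0)) orbF => /orP[//|].
      by rewrite mulf_eq0 sqrf_eq0 (gt_eqF (smooth_sqrt_gt0 _ e0)) pnatr_eq0.
    by rewrite -/g -g0 !mulr0 invr0 mulr0 expr0n mul0r.
  rewrite ler_pdivlMr ?mulr_gt0// mulrAC -[leRHS]mul1r.
  by apply: ler_wpM2r.
move=> /(ler_wpM2l (sqr_ge0 (xi x))).
by lra.
Qed.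

(** The gap lies between 0 and Gamma2(u), and xi^2 Gamma2(u) is in A0, hence
    integrable, although Gamma2(u) need not be. *)
Lemma integrable_cutoff_gap K u xi : 0 <= K -> curvature_dimension M K ->
  A u -> A0 xi ->
  integrable (fun x => xi x ^+ 2 * (Gamma2 u u x - Gamma_sqrt_Gamma M u x)).
Proof.
move=> K0 CD Au A0xi.
have AG2 : A (Gamma2 u u).
  apply: (AZ 2^-1); have [Ag ALu] := conj (Gamma_A Au Au) (L_A Au).
  by apply: AB; [apply: AB|]; [exact: L_A|exact: Gamma_A|exact: Gamma_A].
have iG2 := A0_integrable (A_mul_A0 AG2 (A0_mul A0xi A0xi)).
apply: ae_le_integrable iG2 _.
  apply: measurable_funM.
    by apply: measurable_funX; apply: A_measurable_fun; exact: A0_sub_A A0xi.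
  apply: measurable_funB; first exact: A_measurable_fun AG2.
  exact: measurable_Gamma_sqrt_Gamma.
apply: (ae_mp (curvature_dimension_sqrt CD Au)).
apply: (ae_mp (A_Gamma_ge0 Au)); apply: (ae_mp (Gamma_sqrt_Gamma_ge0 Au)).
apply: ae_all => x G0 g0 D0.
have {}D0 : 0 <= Gamma2 u u x - Gamma_sqrt_Gamma M u x.
  by apply: le_trans D0; rewrite mulr_ge0.
rewrite ger0_norm; last exact: mulr_ge0 (sqr_ge0 _) D0.
by rewrite /= -expr2 ler_wpM2l ?sqr_ge0// gerBl.
Qed.

(** * The geometric Poincare inequality of a stable solution *)

Section stable_solution.
Context (F : R -> R) (hF : smooth1 F).

Lemma weak_solution_ae u : weak_solution M F u ->
  {ae mu, forall x, L u x = - F (u x)}.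
Proof.
move=> [Au wu]; have AFu := A_smooth1 hF Au.
have : {ae mu, forall x, L u x + F (u x) = 0}.
  apply: (ae_eq0_of_tests (AD (L_A Au) AFu)).
  move=> h A0h; have [+ _] := A_ibp Au A0h.
  have iFh := A0_integrable (A_mul_A0 AFu A0h).
  have iLh := A0_integrable (A_mul_A0 (L_A Au) A0h).
  rewrite wu// => E.
  under eq_integral do rewrite mulrDr EFinD.
  rewrite integralD//.
  under [X in (_ + X)%E]eq_integral do rewrite mulrC.
  by rewrite E subee//; exact: integrable_fin_num iLh.
by apply: filterS => x /eqP; rewrite addr_eq0 => /eqP.
Qed.

(** The equation is differentiated: Gamma(u, L u) = - F'(u) Gamma(u). *)
Lemma weak_solution_bochner u : weak_solution M F u ->
  {ae mu, forall x, Gamma2 u u x =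
    2^-1 * L (Gamma u u) x + derive1 F (u x) * Gamma u u x}.
Proof.
move=> wu; have [Au _] := wu; have AFu := A_smooth1 hF Au.
have E : {ae mu, forall x, L u x = -1 * F (u x)}.
  by move: (weak_solution_ae wu); apply: filterS => x ->; rewrite mulN1r.
apply: (ae_mp (GammaC Au (L_A Au))).
apply: (ae_mp (Gamma_ae_eq (L_A Au) (AZ (-1) AFu) Au E)).
apply: (ae_mp (GammaZ (-1) AFu Au)).
apply: (ae_mp (Gamma_chain1 hF Au Au)).
by apply: ae_all => x E1 E2 E3 E4; rewrite /Defs.Gamma2 E4 E3 E2 E1; field.
Qed.

(** What is left over when g^(1/2) is replaced by psi(g) with
    psi = smooth_sqrt e: the first term comes from 2 psi psi' instead of 1, the
    second one from psi(g)^2 instead of g.  The products are arranged so that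
    the function is visibly an element of A0. *)
Definition regularization_error u xi (e : R) (x : X) : R :=
  let g := Gamma u u in
  xi x * Gamma g xi x *
    (2 * (smooth_sqrt e (g x) * derive1 (smooth_sqrt e) (g x)) - 1) +
  (Gamma xi xi x + xi x * xi x * (-1 * derive1 F (u x))) *
    (smooth_sqrt e (g x) ^+ 2 - g x).

Lemma A0_regularization_error u xi e : 0 < e -> A u -> A0 xi ->
  A0 (regularization_error u xi e).
Proof.
move=> e0 Au A0xi; have Ag := Gamma_A Au Au; have Axi := A0_sub_A A0xi.
have se := smooth1_smooth_sqrt e0.
have Ap := A_smooth1 se Ag; have Ad := A_smooth1 (smooth1_derive1 se) Ag.
have AF' := A_smooth1 (smooth1_derive1 hF) Au.
apply: A0D.
  apply: (A_mul_A0 (AB (AZ 2 (A_mul Ap Ad)) (A_cst M 1))).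
  exact: (A_mul_A0 (Gamma_A Ag Axi)).
have App : A (fun x => smooth_sqrt e (Gamma u u x) ^+ 2) by exact: A_mul.
apply: (A_mul_A0 (AB App Ag)); apply: A0D; first exact: Gamma_A0.
exact: (A_mul_A0 (AZ (-1) AF') (A0_mul A0xi A0xi)).
Qed.

(** Dominated convergence along e = (n + 1)^-2.  On the set where g = 0 the
    factor 2 psi psi' - 1 is -1 and does not tend to 0, but there Gamma(g) = 0
    by the improved curvature condition, so Gamma(g, xi) = 0 by
    Cauchy-Schwarz. *)
Lemma regularization_error_cvg0 K u xi :
  curvature_dimension M K -> A u -> A0 xi ->
  \int[mu]_x regularization_error u xi (n.+1%:R^-1 ^+ 2) x @[n --> \oo] --> 0.
Proof.
move=> CD Au A0xi; have Ag := Gamma_A Au Au; have Axi := A0_sub_A A0xi.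
have AF' := A_smooth1 (smooth1_derive1 hF) Au.
pose P x := xi x * Gamma (Gamma u u) xi x.
pose Q x := Gamma xi xi x + xi x * xi x * (-1 * derive1 F (u x)).
have A0P : A0 P by exact: (A_mul_A0 (Gamma_A Ag Axi)).
have A0Q : A0 Q.
  apply: A0D; first exact: Gamma_A0.
  exact: (A_mul_A0 (AZ (-1) AF') (A0_mul A0xi A0xi)).
have n0 n : 0 < n.+1%:R^-1 :> R by rewrite invr_gt0.
apply: (@Rintegral_cvg0_dominated _ _ _ mu _ (fun x => `|P x| + `|Q x|)).
- move=> n; apply: (@A_measurable _ _ _ M); apply: A0_sub_A.
  by apply: A0_regularization_error => //; rewrite exprn_gt0.
- have iP := integrable_norm (A0_integrable A0P).
  have iQ := integrable_norm (A0_integrable A0Q).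
  exact: integrableD iP iQ.
- apply: (ae_mp (Gamma_cauchy_schwarz Ag Axi)).
  apply: (ae_mp (curvature_dimension_refined CD Au)).
  apply: (ae_mp (A_Gamma_ge0 Au)); apply: (ae_mp (A_Gamma_ge0 Ag)).
  apply: ae_all => x gg0 g0 ggle CS.
  have P0 : Gamma u u x = 0 -> P x = 0.
    move=> gx; suff /eqP : Gamma (Gamma u u) xi x ^+ 2 = 0.
      by rewrite sqrf_eq0 /P => /eqP ->; rewrite mulr0.
    apply/eqP; rewrite eq_le sqr_ge0 andbT (le_trans CS)//.
    suff -> : Gamma (Gamma u u) (Gamma u u) x = 0 by rewrite mul0r.
    by apply/eqP; rewrite eq_le gg0 andbT (le_trans ggle)// gx mulr0 mul0r.
  (* Where Gamma(u) = 0 the first term of C is 0, as is P. *)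
  pose C := `|P x| / Gamma u u x + `|Q x|.
  apply: (@squeeze_cvgr _ _ _ _ (fun n => - (n.+1%:R^-1 * C))
    (fun n => n.+1%:R^-1 * C)).
  + apply: nearW => n; rewrite -ler_norml.
    have [/andP[a1 a0] ag /andP[b0 b1]] := smooth_sqrt_bounds (n0 n) g0.
    apply: le_trans (ler_normD _ _) _; rewrite [leRHS]mulrDr.
    apply: lerD; last first.
      by rewrite normrM -/(Q x) (ger0_norm b0) mulrC ler_wpM2r.
    rewrite normrM -/(P x) (ler0_norm a0).
    have [/P0 ->|gx0] := eqVneq (Gamma u u x) 0.
      by rewrite normr0 !mul0r mulr0.
    have gx : 0 < Gamma u u x by rewrite lt0r gx0.
    rewrite [leRHS]mulrCA; apply: ler_wpM2l => //; rewrite ler_pdivlMr// opprB.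
    exact: ag.
  + rewrite -oppr0 -(mul0r C); apply: cvgN; apply: cvgM; last exact: cvg_cst.
    exact: cvg_harmonic.
  + rewrite -(mul0r C); apply: cvgM; last exact: cvg_cst.
    exact: cvg_harmonic.
- apply: (ae_mp (A_Gamma_ge0 Au)); apply: ae_all => x g0 n.
  have [/andP[a1 a0] _ /andP[b0 b1]] := smooth_sqrt_bounds (n0 n) g0.
  apply: le_trans (ler_normD _ _) _.
  apply: lerD; rewrite normrM ?(ler0_norm a0) ?(ger0_norm b0).
    by rewrite -[leRHS]mulr1 ler_wpM2l//; lra.
  by rewrite -[leRHS]mulr1 ler_wpM2l// (le_trans b1)// invf_le1// ler1n.
Qed.

(** Stability is tested with phi = xi psi(g).  By [weak_solution_bochner] the
    potential term F'(u) g xi^2 is xi^2 Gamma2(u) - 1/2 xi^2 L g.  The integral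
    of 1/2 xi^2 L g + xi Gamma(g, xi) is 0, and this disposes at once of the
    term in L g and of the cross term of Gamma(phi). *)
Lemma stable_smooth_sqrt_ge0 K u xi e : 0 <= K -> curvature_dimension M K ->
  stable_solution M F u -> A0 xi -> 0 < e ->
  0 <= \int[mu]_x (Gamma xi xi x * Gamma u u x -
         xi x ^+ 2 * (Gamma2 u u x - Gamma_sqrt_Gamma M u x)) +
       \int[mu]_x regularization_error u xi e x.
Proof.
move=> K0 CD [wu stab] A0xi e0; have [Au _] := wu.
have [Ag Axi] := conj (Gamma_A Au Au) (A0_sub_A A0xi).
have AF' := A_smooth1 (smooth1_derive1 hF) Au.
have se := smooth1_smooth_sqrt e0.
have Ap := A_smooth1 se Ag.
pose phi x := xi x * smooth_sqrt e (Gamma u u x).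
have A0phi : A0 phi by exact: A_mul_A0.
have iGphi := A0_integrable (Gamma_A0 A0phi A0phi).
have iFphi : integrable (fun x => derive1 F (u x) * phi x ^+ 2).
  have := A0_integrable (A_mul_A0 AF' (A0_mul A0phi A0phi)).
  by apply: eq_integrable => // x _ /=; rewrite mulrC expr2.
have iD := integrable_cutoff_gap K0 CD Au A0xi.
have iG := A0_integrable (A_mul_A0 Ag (Gamma_A0 A0xi A0xi)).
have iW := A0_integrable (A0_regularization_error e0 Au A0xi).
(* Integration by parts of Gamma(u) against xi^2, with the factor 1/2 of the
   Bochner identity. *)
pose ibp x := xi x * xi x * (2^-1 * L (Gamma u u) x) +
              xi x * Gamma (Gamma u u) xi x.
have A0ibp : A0 ibp.
  apply: A0D; last exact: (A_mul_A0 (Gamma_A Ag Axi)).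
  exact: (A_mul_A0 (AZ 2^-1 (L_A Ag)) (A0_mul A0xi A0xi)).
have ibp0 : \int[mu]_x ibp x = 0.
  have A0xx := A0_mul A0xi A0xi.
  have iL := A0_integrable (A_mul_A0 (L_A Ag) A0xx).
  have A0xG : A0 (fun x => xi x * Gamma (Gamma u u) xi x).
    exact: A_mul_A0 (Gamma_A Ag Axi) A0xi.
  have E : \int[mu]_x (2 * (xi x * Gamma (Gamma u u) xi x)) =
      - \int[mu]_x (xi x * xi x * L (Gamma u u) x).
    have [H _] := A_ibp Ag A0xx.
    rewrite /Rintegral -fineN -H; apply: ae_eq_Rintegral.
    - exact: A_measurable_fun (AZ 2 (A0_sub_A A0xG)).
    - exact: A_measurable_fun (Gamma_A Ag (A0_sub_A A0xx)).
    - apply: (ae_mp (Gamma_leibnizr Axi Axi Ag)); apply: ae_all => x ->; ring.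
  have -> : \int[mu]_x ibp x =
     \int[mu]_x (2^-1 * (xi x * xi x * L (Gamma u u) x +
                         2 * (xi x * Gamma (Gamma u u) xi x))).
    by apply: eq_Rintegral => x _; rewrite /ibp; field.
  have i2 : integrable (fun x => 2 * (xi x * Gamma (Gamma u u) xi x)).
    exact: integrableZl (A0_integrable A0xG).
  rewrite RintegralZl//; last exact: integrableD iL i2.
  by rewrite RintegralD// E addrC addNr mulr0.
have iibp := A0_integrable A0ibp.
have iB : integrable (fun x => Gamma xi xi x * Gamma u u x -
    xi x ^+ 2 * (Gamma2 u u x - Gamma_sqrt_Gamma M u x)).
  exact: integrableB iG iD.
have iBI := integrableD measurableT iB iibp.
have : 0 <= \int[mu]_x (Gamma phi phi x - derive1 F (u x) * phi x ^+ 2).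
  rewrite RintegralB// /Rintegral -fineB; [|exact: integrable_fin_num..].
  exact: fine_ge0 (stab phi A0phi).
move=> /le_trans; apply.
rewrite -[X in X + _]addr0 -ibp0 -RintegralD// -RintegralD//.
apply: ae_le_Rintegral.
- exact: integrableB iGphi iFphi.
- exact: integrableD iBI iW.
apply: (ae_mp (smooth_sqrt_cutoff_energy_le e0 Au A0xi)).
apply: (ae_mp (weak_solution_bochner wu)).
apply: ae_all => x E H.
rewrite lerBlDr; apply: (le_trans H); rewrite le_eqVlt; apply/orP; left.
by apply/eqP; rewrite /ibp /regularization_error /phi E; field.
Qed.

Lemma stable_geometric_poincare K u xi : 0 <= K -> curvature_dimension M K ->
  stable_solution M F u -> A0 xi ->
  \int[mu]_x (xi x ^+ 2 * (Gamma2 u u x - Gamma_sqrt_Gamma M u x)) <=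
  \int[mu]_x (Gamma xi xi x * Gamma u u x).
Proof.
move=> K0 CD su A0xi; have [[Au _] _] := su.
have iD := integrable_cutoff_gap K0 CD Au A0xi.
have iG := A0_integrable (A_mul_A0 (Gamma_A Au Au) (Gamma_A0 A0xi A0xi)).
rewrite -subr_ge0 -RintegralB// -[leRHS]addr0.
have H : \int[mu]_x (Gamma xi xi x * Gamma u u x -
         xi x ^+ 2 * (Gamma2 u u x - Gamma_sqrt_Gamma M u x)) +
       \int[mu]_x regularization_error u xi (n.+1%:R^-1 ^+ 2) x @[n --> \oo] -->
    \int[mu]_x (Gamma xi xi x * Gamma u u x -
         xi x ^+ 2 * (Gamma2 u u x - Gamma_sqrt_Gamma M u x)) + 0.
  by apply: cvgD; [exact: cvg_cst|exact: regularization_error_cvg0 CD Au A0xi].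
apply: cvgr_to_ge H _; apply: nearW => n.
by apply: (stable_smooth_sqrt_ge0 K0 CD su A0xi); rewrite exprn_gt0// invr_gt0.
Qed.

(** Along the cutoffs, where Gamma(xi_k) <= 1/k, the right-hand side of the
    Poincare inequality is at most the integral of Gamma(u) divided by k.  The
    left-hand side has a nonnegative integrand that increases with k, so it
    vanishes for every fixed cutoff; and almost every point has a cutoff that
    is positive there. *)
Lemma stable_gap_eq0 (K : R) u : 0 <= K -> curvature_dimension M K ->
  stable_solution M F u -> (\int[mu]_x (Gamma u u x)%:E < +oo)%E ->
  {ae mu, forall x, Gamma2 u u x - Gamma_sqrt_Gamma M u x = 0}.
Proof.
move=> K0 CD su intg; have [[Au _] _] := su; have Ag := Gamma_A Au Au.
set D := fun x => Gamma2 u u x - Gamma_sqrt_Gamma M u x.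
have mg := A_measurable_fun Ag.
have g0 := A_Gamma_ge0 Au.
have ig : mu.-integrable [set: borel X] (EFin \o Gamma u u).
  exact: ae_ge0_integrable.
have D0 : {ae mu, forall x, 0 <= D x}.
  apply: (ae_mp (curvature_dimension_sqrt CD Au)); apply: (ae_mp g0).
  by apply: ae_all => x gx; apply: le_trans; rewrite mulr_ge0.
have [xi [A0xi xi_incr xi_cvg xi_Gamma]] := @cutoffs _ _ _ M.
have {}xi_incr : {ae mu, forall x, forall k m, xi k.+1 x <= xi (k.+1 + m)%N x}.
  have : {ae mu, forall x, forall k, xi k.+1 x <= xi k.+2 x}.
    by apply: ae_foralln => k; exact: xi_incr.
  apply: filterS => x H k; elim=> [|m IH]; first by rewrite addn0.
  by rewrite (le_trans IH)// addnS; exact: H.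
set I := \int[mu]_x Gamma u u x.
have bound k : \int[mu]_x (xi k.+1 x ^+ 2 * D x) <= k.+1%:R^-1 * I.
  have [A0k _] := A0xi k.+1 isT.
  apply: le_trans (stable_geometric_poincare K0 CD su A0k) _.
  rewrite -RintegralZl//; apply: ae_le_Rintegral.
  - exact: A0_integrable (A_mul_A0 Ag (Gamma_A0 A0k A0k)).
  - exact: integrableZl ig.
  - apply: (ae_mp (xi_Gamma k.+1 isT)); apply: (ae_mp g0).
    by apply: ae_all => x gx Gx; apply: ler_wpM2r.
have xiD0 k : {ae mu, forall x, xi k.+1 x ^+ 2 * D x = 0}.
  have iD j := integrable_cutoff_gap K0 CD Au (A0xi j.+1 isT).1.
  apply: ae_ge0_Rintegral_eq0; first exact: iD.
    apply: (ae_mp D0); apply: ae_all => x Dx.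
    exact: mulr_ge0 (sqr_ge0 _) Dx.
  (* The cutoff of index k is compared with all later ones. *)
  have lim : (k + n).+1%:R^-1 * I @[n --> \oo] --> (0 : R).
    rewrite -(mul0r I); apply: cvgM; last exact: cvg_cst.
    have := @cvg_harmonic R; rewrite -(cvg_shiftn k).
    by under eq_fun do rewrite addnC.
  apply: cvgr_to_ge lim _; apply: nearW => n.
  apply: le_trans (bound (k + n)%N); apply: ae_le_Rintegral; [exact: iD..|].
  apply: (ae_mp xi_incr); apply: (ae_mp D0); apply: ae_all => x Dx xik.
  have /andP[x0 _] := (A0xi k.+1 isT).2 x.
  have xkn : xi k.+1 x <= xi (k + n).+1 x by rewrite -addSn.
  apply: ler_wpM2r => //; rewrite ler_pXn2r// nnegrE//.
  exact: le_trans xkn.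
have : {ae mu, forall x, forall k, xi k.+1 x ^+ 2 * D x = 0}.
  exact: ae_foralln.
move=> /ae_mp; apply; apply: (ae_mp xi_cvg).
apply: ae_all => x cvg1 xiD.
have [N _ /(_ N.+1 (leqnSn N)) /= H] : \forall k \near \oo, 0 < xi k x.
  exact: (cvgr_gt _ cvg1).
have /eqP := xiD N; rewrite mulf_eq0 sqrf_eq0 (gt_eqF H) /=.
by move=> /eqP.
Qed.

End stable_solution.

(** The set where f is not 0 is open and null, hence empty. *)
Lemma ae_eq0_continuous (f : X -> R) : full_support mu -> continuous f ->
  {ae mu, forall x, f x = 0} -> forall x, f x = 0.
Proof.
move=> supp cf f0 x; apply: contrapT => fx.
pose U := f @^-1` [set~ 0].
have oU : open U.
  apply: open_comp; first by move=> y _; exact: cf.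
  by rewrite openC; exact: closed_eq.
have mU : measurable (U : set (borel X)) by exact: sub_sigma_algebra.
have U0 : mu U = 0%E by exact: (measure_negligible mU).
have := supp U oU (ex_intro _ x fx).
by rewrite U0 ltxx.
Qed.

End markov_triple.

(** * Rigidity of stable solutions *)

Theorem theorem2p6 (R : realType) (X : ptopologicalType)
    (hX : polish_space R X)
    (mu : {sigma_finite_measure set (borel X) -> \bar R})
    (hmu : full_support mu)
    (M : diffusion_markov_triple mu)
    (F : R -> R) (hF : smooth1 F)
    (K : R) (hK : 0 <= K) (hCD : curvature_dimension M K)
    (dist : X * X -> \bar R) (hdist : is_intrinsic_distance M dist)
    (x0 : X)
    (rho_ : nat -> X -> R) (hrhoA : forall k, A M (rho_ k))
    (C0 : R) (hC0 : 0 < C0)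
    (hrho : {ae mu, forall x, (rho_ k x)%:E @[k --> \oo] --> dist (x, x0)})
    (hGrho : forall k,
       (Lnorm mu +oo%E (EFin \o Gamma M (rho_ k) (rho_ k)) <= C0%:E)%E)
    (u : X -> R) (hu : stable_solution M F u)
    (hGu : (\int[mu]_x (Gamma M u u x)%:E < +oo)%E) :
  [/\ 0 < K -> {ae mu, forall x, Gamma M u u x = 0},
      K = 0 -> {ae mu, forall x, Gamma2 M u u x - Gamma_sqrt_Gamma M u x = 0} &
      0 < K -> A M (Gamma M u u) -> continuous (Gamma M u u) ->
        exists c : R, forall x, u x = c].
Proof.
have [[Au _] _] := hu.
have D0 := stable_gap_eq0 hF hK hCD hu hGu.
have Gu0 : 0 < K -> {ae mu, forall x, Gamma M u u x = 0}.
  move=> K0; apply: (ae_mp D0); apply: (ae_mp (A_Gamma_ge0 Au)).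
  apply: (ae_mp (curvature_dimension_sqrt hCD Au)).
  apply: ae_all => x KG G0 D0x; apply/eqP; rewrite eq_le G0 andbT.
  by rewrite -(pmulr_rle0 _ K0) -D0x.
split=> [//|_ //|K0 _ cG].
exact: Gamma_eq0_cst Au (ae_eq0_continuous hmu cG (Gu0 K0)).
Qed.
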